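(* Let $\tilde\nu=\nu\otimes\varpi$ with $\nu\in V_0^*$ and $\varpi\in T^\vee$, and let $\sigma\in S_n$ be a permutation such that ${}^{\sigma}\varpi=\mu_\varpi$ and such that every $\{i,j\}\in R(\sigma)$ satisfies $\varpi_i\neq\varpi_j$. The following assertions are equivalent: (i) $M(\tilde\nu)$ is a simple $\mathbb{H}_k(r,n)$-module; (ii) $M({}^{w}\tilde\nu)$ is a simple $\mathbb{H}_k(r,n)$-module for all $w\in S_n$; (iii) $P_\varpi({}^{\sigma}\nu)=\emptyset$.
   Context: Let $r,n\ge 1$ be integers, $\xi\in\mathbb{C}$ a primitive $r$-th root of unity, $\bar k_0\in\mathbb{C}$. Let $V_0$ be a hermitian space with orthonormal basis $e_1,\dots,e_n$. $S_n$ acts on $V_0$ by $w(e_i)=e_{w(i)}$; $(u,v)$ denotes a transposition. $\theta_i\in U(V_0)$ is the diagonal map with $\theta_i(e_i)=\xi e_i$, $\theta_i(e_j)=e_j$ for $j\ne i$; $T\simeq(\mathbb{Z}/r\mathbb{Z})^n$ is the group generated by the $\theta_i$, and $G=T\rtimes S_n\subset U(V_0)$ (the complex reflection group $G(r,1,n)$). For $u\ne v$ put $\tilde k_{u,v}=\frac{\bar k_0}{2}\sum_{m=0}^{r-1}(\theta_u^m\theta_v^{-m}+\theta_v^m\theta_u^{-m})\in\mathbb{C}T$. $\mathbb{H}_k(r,n)$ is the unital associative $\mathbb{C}$-algebra generated by $e_1,\dots,e_n$ and $t_g$ ($g\in G$), with relations: $e_ie_j=e_je_i$; $t_gt_h=t_{gh}$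 ($t_1=1$); $t_{\theta_i}e_j=e_jt_{\theta_i}$ for all $i,j$; $t_{(j,j+1)}e_i=e_it_{(j,j+1)}$ for $i\ne j,j+1$; $t_{(i,i+1)}e_i=e_{i+1}t_{(i,i+1)}-\tilde k_{i,i+1}$ for $1\le i\le n-1$ (with $\tilde k_{i,i+1}\in\mathbb{C}T$ viewed in the algebra via $g\mapsto t_g$). One writes $g$ for $t_g$. $\mathcal{C}=S(V_0)\otimes\mathbb{C}T$ is the commutative subalgebra generated by the $e_i$ and $T$. For $\gamma\in V_0^*$ and $\mu\in T^\vee$ (the characters $T\to\mathbb{C}^*$), $\gamma\otimes\mu$ denotes the algebra character of $\mathcal{C}$ with $e_i\mapsto\gamma(e_i)$, $t\mapsto\mu(t)$ ($t\in T$). $S_n$ acts by ${}^{w}(\gamma\otimes\mu)={}^{w}\gamma\otimes{}^{w}\mu$, with ${}^{w}\gamma(\zeta)=\gamma(w^{-1}\zeta)$, ${}^{w}\mu(t)=\mu(w^{-1}tw)$. The principal series module of $\tilde\gamma=\gamma\otimes\mu$ is $M(\tilde\gamma)=\mathbb{H}_k(r,n)\otimes_{\mathcal{C}}\mathbb{C}m_{\tilde\gamma}$, where $\mathbb{C}m_{\tilde\gamma}$ is the one-dimensional $\mathcal{C}$-module of character $\tilde\gamma$. For $w\in S_n$, $R(w)=\{\{i,j\}: 1\le i<j\le n,\ w(j)<w(i)\}$. For $\varpi\in T^\vee$, $\varpi_s\in\{0,\dots,r-1\}$ is defined by $\varpi(\theta_s)=\xi^{\varpi_s}$, and $\varpi^{[j]}=\#\{s:\varpi_s=j\}$.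 $\mu_\varpi\in T^\vee$ is the character whose sequence of exponents is the nondecreasing sequence $(0^{\varpi^{[0]}},1^{\varpi^{[1]}},\dots,(r-1)^{\varpi^{[r-1]}})$ (exponents denote repetitions). $S_n(\mu)$ is the stabilizer of $\mu$ in $S_n$. For $\gamma\in V_0^*$, $P_\varpi(\gamma)$ is the set of transpositions $(i,j)\in S_n(\mu_\varpi)$ such that $\gamma(e_i-e_j)=r\bar k_0$ or $\gamma(e_i-e_j)=-r\bar k_0$. *)

(* Defs.v *)
From HB Require Import structures.
From mathcomp Require Import all_boot all_order all_fingroup all_algebra.
From mathcomp Require Import generic_quotient sesquilinear spectral.
From mathcomp Require Import complex boolp reals.

Set Implicit Arguments.
Unset Strict Implicit.
Unset Printing Implicit Defensive.

Import Order.TTheory GRing.Theory Num.Theory.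

Local Open Scope ring_scope.
Local Open Scope quotient_scope.

Inductive aterm (K X : Type) : Type :=
| AGen of X
| AScal of K
| AAdd of aterm K X & aterm K X
| AMul of aterm K X & aterm K X.

Arguments AGen {K X}.
Arguments AScal {K X}.

Declare Scope aterm_scope.
Delimit Scope aterm_scope with AT.
Bind Scope aterm_scope with aterm.
Notation "s + t" := (AAdd s t) : aterm_scope.
Notation "s * t" := (AMul s t) : aterm_scope.
Notation "c %:S" := (AScal c) (at level 1, format "c %:S") : aterm_scope.

HB.instance Definition _ (K X : Type) := gen_eqMixin (aterm K X).
HB.instance Definition _ (K X : Type) := gen_choiceMixin (aterm K X).

Section PresentedAlgebra.
Variables (K : comNzRingType) (X : Type).
Variable rel : aterm K X -> aterm K X -> Prop.

Local Open Scope aterm_scope.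

(* The least congruence containing rel for which the quotient is a
   K-algebra, the scalar c being embedded as c%:S. *)
Inductive acong : aterm K X -> aterm K X -> Prop :=
| acong_refl s : acong s s
| acong_sym s t : acong s t -> acong t s
| acong_trans s t u : acong s t -> acong t u -> acong s u
| acong_add s s' t t' : acong s s' -> acong t t' -> acong (s + t) (s' + t')
| acong_mul s s' t t' : acong s s' -> acong t t' -> acong (s * t) (s' * t')
| acong_addA s t u : acong (s + (t + u)) (s + t + u)
| acong_addC s t : acong (s + t) (t + s)
| acong_add0 s : acong (0%R%:S + s) s
| acong_addN s : acong ((-1)%R%:S * s + s) 0%R%:S
| acong_mulA s t u : acong (s * (t * u)) (s * t * u)
| acong_mul1 s : acong (1%R%:S * s) s
| acong_mulDl s t u : acong ((s + t) * u) (s * u + t * u)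
| acong_mulDr s t u : acong (s * (t + u)) (s * t + s * u)
| acong_scalD c d : acong (c + d)%R%:S (c%:S + d%:S)
| acong_scalM c d : acong (c * d)%R%:S (c%:S * d%:S)
| acong_scalC c s : acong (s * c%:S) (c%:S * s)
| acong_rel s t : rel s t -> acong s t.

Definition acongb s t : bool := `[< acong s t >].

Lemma acongb_refl : reflexive acongb.
Proof. by move=> s; apply/asboolP; exact: acong_refl. Qed.

Lemma acongb_sym : symmetric acongb.
Proof. by move=> s t; apply/asboolP/asboolP; exact: acong_sym. Qed.

Lemma acongb_trans : transitive acongb.
Proof.
by move=> t s u /asboolP st /asboolP tu; apply/asboolP; exact: acong_trans tu.
Qed.

Canonical acong_equiv := EquivRel acongb acongb_refl acongb_sym acongb_trans.

Definition palg := {eq_quot acong_equiv}.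

HB.instance Definition _ := Choice.on palg.

Definition pcls (s : aterm K X) : palg := \pi_{eq_quot acong_equiv} s.

Lemma pclsP s t : pcls s = pcls t <-> acong s t.
Proof.
split=> [/eqmodP/asboolP //|st]; apply/eqmodP; exact/asboolP.
Qed.

Lemma pclsW (P : palg -> Prop) : (forall s, P (pcls s)) -> forall x, P x.
Proof. exact: quotW. Qed.

Definition palg_add (x y : palg) : palg := pcls (repr x + repr y).
Definition palg_mul (x y : palg) : palg := pcls (repr x * repr y).
Definition palg_opp (x : palg) : palg := pcls ((-1)%R%:S * repr x).
Definition palg_scale (c : K) (x : palg) : palg := pcls (c%:S * repr x).

Lemma repr_pcls s : acong (repr (pcls s)) s.
Proof. by apply/pclsP; rewrite /pcls reprK. Qed.

Lemma palg_addE s t : palg_add (pcls s) (pcls t) = pcls (s + t).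
Proof. by apply/pclsP; apply: acong_add; exact: repr_pcls. Qed.

Lemma palg_mulE s t : palg_mul (pcls s) (pcls t) = pcls (s * t).
Proof. by apply/pclsP; apply: acong_mul; exact: repr_pcls. Qed.

Lemma palg_oppE s : palg_opp (pcls s) = pcls ((-1)%R%:S * s).
Proof.
by apply/pclsP; apply: acong_mul; [exact: acong_refl|exact: repr_pcls].
Qed.

Lemma palg_scaleE c s : palg_scale c (pcls s) = pcls (c%:S * s).
Proof.
by apply/pclsP; apply: acong_mul; [exact: acong_refl|exact: repr_pcls].
Qed.

Lemma palg_addA : associative palg_add.
Proof.
elim/pclsW=> s; elim/pclsW=> t; elim/pclsW=> u; rewrite !palg_addE.
exact/pclsP/acong_addA.
Qed.

Lemma palg_addC : commutative palg_add.
Proof.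
elim/pclsW=> s; elim/pclsW=> t; rewrite !palg_addE.
exact/pclsP/acong_addC.
Qed.

Lemma palg_add0 : left_id (pcls 0%R%:S) palg_add.
Proof. elim/pclsW=> s; rewrite palg_addE; exact/pclsP/acong_add0. Qed.

Lemma palg_addN : left_inverse (pcls 0%R%:S) palg_opp palg_add.
Proof. elim/pclsW=> s; rewrite palg_oppE palg_addE; exact/pclsP/acong_addN. Qed.

HB.instance Definition _ :=
  GRing.isZmodule.Build palg palg_addA palg_addC palg_add0 palg_addN.

Lemma palg_mulA : associative palg_mul.
Proof.
elim/pclsW=> s; elim/pclsW=> t; elim/pclsW=> u; rewrite !palg_mulE.
exact/pclsP/acong_mulA.
Qed.

Lemma palg_mul1 : left_id (pcls 1%R%:S) palg_mul.
Proof. elim/pclsW=> s; rewrite palg_mulE; exact/pclsP/acong_mul1. Qed.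

Lemma palg_mulr1 : right_id (pcls 1%R%:S) palg_mul.
Proof.
elim/pclsW=> s; rewrite palg_mulE; apply/pclsP.
exact: acong_trans (acong_scalC _ _) (acong_mul1 _).
Qed.

Lemma palg_mulDl : left_distributive palg_mul palg_add.
Proof.
elim/pclsW=> s; elim/pclsW=> t; elim/pclsW=> u.
rewrite !(palg_addE, palg_mulE); exact/pclsP/acong_mulDl.
Qed.

Lemma palg_mulDr : right_distributive palg_mul palg_add.
Proof.
elim/pclsW=> s; elim/pclsW=> t; elim/pclsW=> u.
rewrite !(palg_addE, palg_mulE); exact/pclsP/acong_mulDr.
Qed.

HB.instance Definition _ := GRing.Zmodule_isPzRing.Build palg
  palg_mulA palg_mul1 palg_mulr1 palg_mulDl palg_mulDr.

Lemma pclsD s t : pcls (s + t) = (pcls s + pcls t)%R.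
Proof. by rewrite -palg_addE. Qed.

Lemma pclsM s t : pcls (s * t) = (pcls s * pcls t)%R.
Proof. by rewrite -palg_mulE. Qed.

Lemma pcls0 : pcls 0%R%:S = 0%R. Proof. by []. Qed.

Lemma pcls1 : pcls 1%R%:S = 1%R. Proof. by []. Qed.

Lemma palg_scaleM c (x : palg) : palg_scale c x = (pcls c%:S * x)%R.
Proof. by elim/pclsW: x => s; rewrite palg_scaleE pclsM. Qed.

Fact palg_scaleA a b (x : palg) :
  palg_scale a (palg_scale b x) = palg_scale (a * b)%R x.
Proof.
rewrite !palg_scaleM mulrA -pclsM; congr (_ * _)%R.
exact/pclsP/acong_sym/acong_scalM.
Qed.

Fact palg_scale1 : left_id 1%R palg_scale.
Proof. by move=> x; rewrite palg_scaleM pcls1 mul1r. Qed.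

Fact palg_scaleDr : right_distributive palg_scale +%R.
Proof. by move=> c x y; rewrite !palg_scaleM mulrDr. Qed.

Fact palg_scaleDl (x : palg) :
  {morph palg_scale^~ x : a b / (a + b)%R}.
Proof.
move=> a b; rewrite !palg_scaleM -mulrDl -pclsD; congr (_ * _)%R.
exact/pclsP/acong_scalD.
Qed.

HB.instance Definition _ := GRing.Zmodule_isLmodule.Build K palg
  palg_scaleA palg_scale1 palg_scaleDr palg_scaleDl.

Lemma pclsS c : pcls c%:S = (c *: (1%R : palg))%R.
Proof. by rewrite [RHS]palg_scaleM mulr1. Qed.

Lemma palg_scaleAl (c : K) (x y : palg) : (c *: (x * y) = (c *: x) * y)%R.
Proof.
have E z : (c *: z)%R = (pcls c%:S * z)%R by exact: palg_scaleM.
by rewrite !E mulrA.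
Qed.

Lemma palg_scaleAr (c : K) (x y : palg) : (c *: (x * y) = x * (c *: y))%R.
Proof.
have E z : (c *: z)%R = (pcls c%:S * z)%R by exact: palg_scaleM.
rewrite !E !mulrA; congr (_ * _)%R.
by elim/pclsW: x => s; rewrite -!pclsM; apply/pclsP/acong_sym/acong_scalC.
Qed.

Section Lift.
Variables (A : pzRingType) (sA : {rmorphism K -> A}) (f : X -> A).

Fixpoint aeval (s : aterm K X) : A :=
  match s with
  | AGen x => f x
  | AScal c => sA c
  | AAdd s t => (aeval s + aeval t)%R
  | AMul s t => (aeval s * aeval t)%R
  end.

Definition palg_lift (x : palg) : A := aeval (repr x).

Hypothesis sA_central : forall c s, (aeval s * sA c = sA c * aeval s)%R.
Hypothesis f_rel : forall s t, rel s t -> aeval s = aeval t.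

Lemma aeval_cong s t : acong s t -> aeval s = aeval t.
Proof.
elim=> //= {s t}.
- by move=> s t u _ -> _ ->.
- by move=> s s' t t' _ -> _ ->.
- by move=> s s' t t' _ -> _ ->.
- by move=> s t u; rewrite addrA.
- by move=> s t; rewrite addrC.
- by move=> s; rewrite rmorph0 add0r.
- by move=> s; rewrite rmorphN1 mulN1r addNr rmorph0.
- by move=> s t u; rewrite mulrA.
- by move=> s; rewrite rmorph1 mul1r.
- by move=> s t u; rewrite mulrDl.
- by move=> s t u; rewrite mulrDr.
- by move=> c d; rewrite rmorphD.
- by move=> c d; rewrite rmorphM.
Qed.

Lemma palg_liftE s : palg_lift (pcls s) = aeval s.
Proof. exact/aeval_cong/repr_pcls. Qed.

Lemma palg_lift_is_zmod_morphism : zmod_morphism palg_lift.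
Proof.
elim/pclsW=> s; elim/pclsW=> t.
have -> : (- pcls t)%R = pcls ((-1)%R%:S * t) by exact: palg_oppE.
by rewrite -pclsD !palg_liftE /= rmorphN1 mulN1r.
Qed.

Lemma palg_lift_is_monoid_morphism : monoid_morphism palg_lift.
Proof.
split; first by rewrite -pcls1 palg_liftE /= rmorph1.
by elim/pclsW=> s; elim/pclsW=> t; rewrite -pclsM !palg_liftE.
Qed.

Definition palg_liftM : {rmorphism palg -> A} :=
  HB.pack palg_lift
    (GRing.isZmodMorphism.Build palg A palg_lift palg_lift_is_zmod_morphism)
    (GRing.isMonoidMorphism.Build palg A palg_lift
       palg_lift_is_monoid_morphism).

End Lift.

End PresentedAlgebra.

Inductive tterm (A N : Type) : Type :=
| TPure of A & N
| TZero
| TOpp of tterm A N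
| TAdd of tterm A N & tterm A N.

Arguments TZero {A N}.

HB.instance Definition _ (A N : Type) := gen_eqMixin (tterm A N).
HB.instance Definition _ (A N : Type) := gen_choiceMixin (tterm A N).

(* The tensor product of A and N over S, where A is a right S-module through
   f; the left A-module structure is a *: (b (x) v) = (a * b) (x) v. *)
Section ExtensionOfScalars.
Variables (S A : pzRingType) (f : {rmorphism S -> A}) (N : lmodType S).

Inductive tcong : tterm A N -> tterm A N -> Prop :=
| tcong_refl x : tcong x x
| tcong_sym x y : tcong x y -> tcong y x
| tcong_trans x y z : tcong x y -> tcong y z -> tcong x z
| tcong_opp x x' : tcong x x' -> tcong (TOpp x) (TOpp x')
| tcong_add x x' y y' :
    tcong x x' -> tcong y y' -> tcong (TAdd x y) (TAdd x' y')
| tcong_addA x y z : tcong (TAdd x (TAdd y z)) (TAdd (TAdd x y) z)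
| tcong_addC x y : tcong (TAdd x y) (TAdd y x)
| tcong_add0 x : tcong (TAdd TZero x) x
| tcong_addN x : tcong (TAdd (TOpp x) x) TZero
| tcong_Dl a b v : tcong (TPure (a + b) v) (TAdd (TPure a v) (TPure b v))
| tcong_Dr a v w : tcong (TPure a (v + w)) (TAdd (TPure a v) (TPure a w))
| tcong_bal a s v : tcong (TPure (a * f s) v) (TPure a (s *: v)).

Definition tcongb x y : bool := `[< tcong x y >].

Lemma tcongb_refl : reflexive tcongb.
Proof. by move=> s; apply/asboolP; exact: tcong_refl. Qed.

Lemma tcongb_sym : symmetric tcongb.
Proof. by move=> s t; apply/asboolP/asboolP; exact: tcong_sym. Qed.

Lemma tcongb_trans : transitive tcongb.
Proof.
by move=> t s u /asboolP st /asboolP tu; apply/asboolP; exact: tcong_trans tu.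
Qed.

Canonical tcong_equiv := EquivRel tcongb tcongb_refl tcongb_sym tcongb_trans.

Definition tensor := {eq_quot tcong_equiv}.

HB.instance Definition _ := Choice.on tensor.

Definition tcls (x : tterm A N) : tensor := \pi_{eq_quot tcong_equiv} x.

Definition pure (a : A) (v : N) : tensor := tcls (TPure a v).

Lemma tclsP x y : tcls x = tcls y <-> tcong x y.
Proof.
split=> [/eqmodP/asboolP //|xy]; apply/eqmodP; exact/asboolP.
Qed.

Lemma tclsW (P : tensor -> Prop) : (forall x, P (tcls x)) -> forall x, P x.
Proof. exact: quotW. Qed.

Fixpoint tact (a : A) (x : tterm A N) : tterm A N :=
  match x with
  | TPure b v => TPure (a * b) v
  | TZero => TZero
  | TOpp x => TOpp (tact a x)
  | TAdd x y => TAdd (tact a x) (tact a y)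
  end.

Lemma tact_cong a x y : tcong x y -> tcong (tact a x) (tact a y).
Proof.
elim=> {x y} /=.
- by move=> x; exact: tcong_refl.
- by move=> x y _; exact: tcong_sym.
- by move=> x y z _ xy _; exact: tcong_trans xy.
- by move=> x x' _; exact: tcong_opp.
- by move=> x x' y y' _ xx' _; exact: tcong_add.
- by move=> x y z; exact: tcong_addA.
- by move=> x y; exact: tcong_addC.
- by move=> x; exact: tcong_add0.
- by move=> x; exact: tcong_addN.
- by move=> b c v; rewrite mulrDr; exact: tcong_Dl.
- by move=> b v w; exact: tcong_Dr.
- by move=> b s v; rewrite mulrA; exact: tcong_bal.
Qed.

Definition tensor_add (x y : tensor) : tensor := tcls (TAdd (repr x) (repr y)).
Definition tensor_opp (x : tensor) : tensor := tcls (TOpp (repr x)).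
Definition tensor_scale (a : A) (x : tensor) : tensor := tcls (tact a (repr x)).

Lemma repr_tcls x : tcong (repr (tcls x)) x.
Proof. by apply/tclsP; rewrite /tcls reprK. Qed.

Lemma tensor_addE x y : tensor_add (tcls x) (tcls y) = tcls (TAdd x y).
Proof. by apply/tclsP; apply: tcong_add; exact: repr_tcls. Qed.

Lemma tensor_oppE x : tensor_opp (tcls x) = tcls (TOpp x).
Proof. by apply/tclsP/tcong_opp/repr_tcls. Qed.

Lemma tensor_scaleE a x : tensor_scale a (tcls x) = tcls (tact a x).
Proof. by apply/tclsP/tact_cong/repr_tcls. Qed.

Fact tensor_addA : associative tensor_add.
Proof.
elim/tclsW=> x; elim/tclsW=> y; elim/tclsW=> z; rewrite !tensor_addE.
exact/tclsP/tcong_addA.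
Qed.

Fact tensor_addC : commutative tensor_add.
Proof.
elim/tclsW=> x; elim/tclsW=> y; rewrite !tensor_addE.
exact/tclsP/tcong_addC.
Qed.

Fact tensor_add0 : left_id (tcls TZero) tensor_add.
Proof. elim/tclsW=> x; rewrite tensor_addE; exact/tclsP/tcong_add0. Qed.

Fact tensor_addN : left_inverse (tcls TZero) tensor_opp tensor_add.
Proof.
elim/tclsW=> x; rewrite tensor_oppE tensor_addE; exact/tclsP/tcong_addN.
Qed.

HB.instance Definition _ := GRing.isZmodule.Build tensor
  tensor_addA tensor_addC tensor_add0 tensor_addN.

Lemma tcls0 : tcls TZero = 0. Proof. by []. Qed.

Lemma tclsD x y : tcls (TAdd x y) = tcls x + tcls y.
Proof. by rewrite -tensor_addE. Qed.

Lemma tclsN x : tcls (TOpp x) = - tcls x.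
Proof. by rewrite -tensor_oppE. Qed.

Lemma pureDl a b v : pure (a + b) v = pure a v + pure b v.
Proof. rewrite -tclsD; exact/tclsP/tcong_Dl. Qed.

Lemma pureDr a v w : pure a (v + w) = pure a v + pure a w.
Proof. rewrite -tclsD; exact/tclsP/tcong_Dr. Qed.

Lemma pure_bal a s v : pure (a * f s) v = pure a (s *: v).
Proof. exact/tclsP/tcong_bal. Qed.

Lemma tensor_ind (P : tensor -> Prop) :
  (forall a v, P (pure a v)) -> P 0 -> (forall x, P x -> P (- x)) ->
  (forall x y, P x -> P y -> P (x + y)) -> forall x, P x.
Proof.
move=> P1 P0 PN PD; elim/tclsW; elim=> [a v||x|x Px y Py].
- exact: P1.
- exact: P0.
- by rewrite tclsN; exact: PN.
- by rewrite tclsD; exact: PD.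
Qed.

Fact tensor_scaleDr : right_distributive tensor_scale +%R.
Proof.
by move=> a; elim/tclsW=> x; elim/tclsW=> y; rewrite -tclsD !tensor_scaleE -tclsD.
Qed.

Let tensor_scaleN a x : tensor_scale a (- x) = - tensor_scale a x.
Proof. by elim/tclsW: x => x; rewrite -tclsN !tensor_scaleE -tclsN. Qed.

Let tensor_scale0 a : tensor_scale a 0 = 0.
Proof. by rewrite -tcls0 tensor_scaleE. Qed.

Let tensor_scale_pure a b v : tensor_scale a (pure b v) = pure (a * b) v.
Proof. exact: tensor_scaleE. Qed.

Fact tensor_scaleA a b x :
  tensor_scale a (tensor_scale b x) = tensor_scale (a * b) x.
Proof.
elim/tensor_ind: x => [c v||x IH|x y IHx IHy].
- by rewrite !tensor_scale_pure mulrA.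
- by rewrite !tensor_scale0.
- by rewrite !tensor_scaleN IH.
- by rewrite !tensor_scaleDr IHx IHy.
Qed.

Fact tensor_scale1 : left_id 1 tensor_scale.
Proof.
elim/tensor_ind=> [c v||x IH|x y IHx IHy].
- by rewrite !tensor_scale_pure mul1r.
- by rewrite !tensor_scale0.
- by rewrite !tensor_scaleN IH.
- by rewrite !tensor_scaleDr IHx IHy.
Qed.

Fact tensor_scaleDl x : {morph tensor_scale^~ x : a b / a + b}.
Proof.
move=> a b; elim/tensor_ind: x => [c v||x IH|x y IHx IHy].
- by rewrite !tensor_scale_pure mulrDl pureDl.
- by rewrite !tensor_scale0 addr0.
- by rewrite !tensor_scaleN IH opprD.
- by rewrite !tensor_scaleDr IHx IHy addrACA.
Qed.

HB.instance Definition _ := GRing.Zmodule_isLmodule.Build A tensor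
  tensor_scaleA tensor_scale1 tensor_scaleDr tensor_scaleDl.

Lemma scale_pure a b v : a *: pure b v = pure (a * b) v.
Proof. exact: tensor_scale_pure. Qed.

End ExtensionOfScalars.

(* The line K with S acting through chi. *)
Definition char_line (S K : pzRingType) (chi : {rmorphism S -> K}) : Type := K.

Section CharLine.
Variables (S K : pzRingType) (chi : {rmorphism S -> K}).
Local Notation L := (char_line chi).

HB.instance Definition _ := GRing.Zmodule.copy L K.

Definition char_scale (s : S) (v : L) : L := chi s * (v : K).

Fact char_scaleA a b v : char_scale a (char_scale b v) = char_scale (a * b) v.
Proof. by rewrite /char_scale rmorphM mulrA. Qed.

Fact char_scale1 : left_id 1 char_scale.
Proof. by move=> v; rewrite /char_scale rmorph1 mul1r. Qed.

Fact char_scaleDr : right_distributive char_scale +%R.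
Proof. by move=> a v w; rewrite /char_scale mulrDr. Qed.

Fact char_scaleDl v : {morph char_scale^~ v : a b / a + b}.
Proof. by move=> a b; rewrite /char_scale rmorphD mulrDl. Qed.

HB.instance Definition _ := GRing.Zmodule_isLmodule.Build S L
  char_scaleA char_scale1 char_scaleDr char_scaleDl.

End CharLine.

Definition simple_module (A : pzRingType) (M : lmodType A) : Prop :=
  (exists v : M, v != 0) /\
  (forall N : {pred M}, submod_closed N ->
     (forall v, v \in N -> v = 0) \/ (forall v, v \in N)).

(* V_0 is 'cV[R[i]]_n with its standard hermitian form; U(V_0) acts on it by
   left multiplication. *)
Section UnitaryGroup.
Variables (R : realType) (n : nat).

Record unitary := Unitary { umx :> 'M[R[i]]_n; _ : umx \is unitarymx }.

HB.instance Definition _ := [isSub for umx].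
HB.instance Definition _ := [Choice of unitary by <:].

Fact unitary1_subproof : (1%:M : 'M[R[i]]_n) \is unitarymx.
Proof. by apply/unitarymxP; rewrite mul1mx trmx1 map_mx1. Qed.

Fact unitaryM_subproof (g h : unitary) : umx g *m umx h \is unitarymx.
Proof. by apply: mul_unitarymx; [case: g|case: h]. Qed.

Fact unitaryV_subproof (g : unitary) : invmx g \is unitarymx.
Proof.
by case: g => g gU /=; rewrite invmx_unitary // trmxC_unitary.
Qed.

Let one_unitary := Unitary unitary1_subproof.
Let mul_unitary g h := Unitary (unitaryM_subproof g h).
Let inv_unitary g := Unitary (unitaryV_subproof g).

Fact mulA_unitary : associative mul_unitary.
Proof. by move=> f g h; apply/val_inj; rewrite /= mulmxA. Qed.

Fact mul1_unitary : left_id one_unitary mul_unitary.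
Proof. by move=> g; apply/val_inj; rewrite /= mul1mx. Qed.

Fact mulr1_unitary : right_id one_unitary mul_unitary.
Proof. by move=> g; apply/val_inj; rewrite /= mulmx1. Qed.

Fact mulV_unitary : left_inverse one_unitary inv_unitary mul_unitary.
Proof.
by case=> g gU; apply/val_inj; rewrite /= mulVmx // unitarymx_unit.
Qed.

Fact mulrV_unitary : right_inverse one_unitary inv_unitary mul_unitary.
Proof.
by case=> g gU; apply/val_inj; rewrite /= mulmxV // unitarymx_unit.
Qed.

HB.instance Definition _ := isGroup.Build unitary
  mulA_unitary mul1_unitary mulr1_unitary mulV_unitary mulrV_unitary.

Lemma umx1 : umx 1%g = 1%:M. Proof. by []. Qed.

Lemma umxM g h : umx (g * h)%g = umx g *m umx h. Proof. by []. Qed.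

Definition basis_vec (i : 'I_n) : 'cV[R[i]]_n := delta_mx i 0.

(* The matrix of e_i |-> e_(w i). As MathComp composes permutations from left
   to right, perm_unitary reverses products. *)
Definition permutation_mx (w : 'S_n) : 'M[R[i]]_n :=
  \matrix_(i, j) (i == w j)%:R.

Lemma permutation_mxE w : permutation_mx w = perm_mx w^-1.
Proof.
apply/matrixP=> i j; rewrite !mxE; congr (_ : bool)%:R.
by rewrite -[RHS](inj_eq (@perm_inj _ w)) permKV.
Qed.

Fact permutation_mx_unitary w : permutation_mx w \is unitarymx.
Proof.
apply/unitarymxP; rewrite permutation_mxE tr_perm_mx map_perm_mx.
by rewrite -perm_mxM mulgV perm_mx1.
Qed.

Definition perm_unitary w := Unitary (permutation_mx_unitary w).

Lemma perm_unitary_basis w i :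
  umx (perm_unitary w) *m basis_vec i = basis_vec (w i).
Proof.
by apply/colP=> j; rewrite -colE !mxE eqxx andbT.
Qed.

Lemma perm_unitaryM v w :
  (perm_unitary v * perm_unitary w)%g = perm_unitary (w * v).
Proof.
by apply/val_inj; rewrite /= !permutation_mxE -perm_mxM invMg.
Qed.

Lemma perm_unitary1 : perm_unitary 1 = 1%g.
Proof. by apply/val_inj; rewrite /= permutation_mxE invg1 perm_mx1. Qed.

Lemma perm_unitaryV w : (perm_unitary w)^-1%g = perm_unitary w^-1.
Proof.
apply: (@mulgI _ (perm_unitary w)).
by rewrite mulgV perm_unitaryM mulVg perm_unitary1.
Qed.

End UnitaryGroup.

Section ReflectionGroup.
Variables (R : realType) (r n : nat) (xi : R[i]).
Hypothesis hxi : r.-primitive_root xi.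

Local Notation U := (unitary R n).
Local Notation P := (@perm_unitary R n).

Definition theta_row (i : 'I_n) : 'rV[R[i]]_n :=
  \row_j (if j == i then xi else 1).

Fact theta_unitary i : diag_mx (theta_row i) \is unitarymx.
Proof.
have nxi : `|xi| = 1.
  apply/eqP; rewrite -(@pexpr_eq1 _ _ r) ?normr_ge0 ?(prim_order_gt0 hxi) //.
  by rewrite -normrX (prim_expr_order hxi) normr1.
apply/unitarymxP; rewrite tr_diag_mx map_diag_mx mulmx_diag -diag_const_mx.
congr diag_mx; apply/rowP=> j; rewrite !mxE; case: eqP => _.
- by rewrite -normCK nxi expr1n.
- by rewrite rmorph1 mulr1.
Qed.

Definition theta i : U := Unitary (theta_unitary i).

Inductive generated_by_theta : U -> Prop :=
| generated_theta i : generated_by_theta (theta i)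
| generated_1 : generated_by_theta 1%g
| generated_M s t :
    generated_by_theta s -> generated_by_theta t -> generated_by_theta (s * t)%g
| generated_V t : generated_by_theta t -> generated_by_theta t^-1%g.

Definition in_torus : {pred U} := [pred t | `[< generated_by_theta t >]].

Lemma in_torusP t : reflect (generated_by_theta t) (t \in in_torus).
Proof. exact: asboolP. Qed.

Fact in_torus_closed : group_closed in_torus.
Proof.
split=> [|s t /in_torusP hs /in_torusP ht]; apply/in_torusP.
  exact: generated_1.
exact/generated_M/generated_V.
Qed.

Record torus := Torus { tval :> U; _ : tval \in in_torus }.

HB.instance Definition _ := [isSub for tval].
HB.instance Definition _ := [Choice of torus by <:].
HB.instance Definition _ :=
  SubChoice_isSubGroup.Build U in_torus torus in_torus_closed.

Fact theta_in_torus i : theta i \in in_torus.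
Proof. exact/in_torusP/generated_theta. Qed.

Definition theta_torus i : torus := Torus (theta_in_torus i).

Lemma theta_conj i w : (theta i ^ P w)%g = theta (w^-1%g i).
Proof.
rewrite conjgE; apply: (canLR (mulKg _)).
apply/val_inj/matrixP => j k; rewrite /= mul_diag_mx mul_mx_diag !mxE.
case: (j =P w k) => [->|_]; last by rewrite mulr0 mul0r.
rewrite mulr1 mul1r; congr (if _ then _ else _).
by rewrite -(inj_eq (@perm_inj _ w^-1%g)) permK.
Qed.

Lemma in_torus_conj t w : t \in in_torus -> (t ^ P w)%g \in in_torus.
Proof.
move/in_torusP=> ht; apply/in_torusP; elim: ht => [i||s u _ hs _ hu|u _ hu].
- rewrite theta_conj; exact: generated_theta.
- rewrite conj1g; exact: generated_1.
- rewrite conjMg; exact: generated_M.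
- rewrite conjVg; exact: generated_V.
Qed.

Definition torus_conj (w : 'S_n) (t : torus) : torus :=
  Torus (in_torus_conj w (valP t)).

Lemma torus_conjM w s t :
  torus_conj w (s * t)%g = (torus_conj w s * torus_conj w t)%g.
Proof. by apply/val_inj; rewrite /= conjMg. Qed.

Lemma torus_conj1 w : torus_conj w 1%g = 1%g.
Proof. by apply/val_inj; rewrite /= conj1g. Qed.

Definition in_reflection_group : {pred U} :=
  [pred g | `[< exists2 t, t \in in_torus & exists w, g = (t * P w)%g >]].

Lemma in_reflection_groupP g :
  reflect (exists2 t, t \in in_torus & exists w, g = (t * P w)%g)
          (g \in in_reflection_group).
Proof. exact: asboolP. Qed.

Fact in_reflection_group_closed : group_closed in_reflection_group.
Proof.
have [T1 TF] := in_torus_closed.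
split=> [|g h /in_reflection_groupP[s hs [v ->]]].
  apply/in_reflection_groupP; exists 1%g => //; exists 1%g.
  by rewrite perm_unitary1 mulg1.
move=> /in_reflection_groupP[t ht [w ->]]; apply/in_reflection_groupP.
have [u hu] : exists u, (P v * (P w)^-1)%g = P u.
  by exists (w^-1 * v)%g; rewrite perm_unitaryV perm_unitaryM.
exists (s * (t ^ P u^-1)^-1)%g; first exact/TF/in_torus_conj.
exists u; rewrite -perm_unitaryV -conjVg conjgE invgK invgM -!mulgA.
by rewrite mulVg mulg1 -hu !mulgA.
Qed.

Record reflection_group :=
  ReflectionGroup { gval :> U; _ : gval \in in_reflection_group }.

HB.instance Definition _ := [isSub for gval].
HB.instance Definition _ := [Choice of reflection_group by <:].
HB.instance Definition _ := SubChoice_isSubGroup.Build U in_reflection_group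
  reflection_group in_reflection_group_closed.

Fact torus_in_reflection_group (t : torus) :
  (t : U) \in in_reflection_group.
Proof.
apply/in_reflection_groupP; exists (t : U); first exact: valP.
by exists 1%g; rewrite perm_unitary1 mulg1.
Qed.

Definition of_torus t : reflection_group :=
  ReflectionGroup (torus_in_reflection_group t).

Fact perm_in_reflection_group w : P w \in in_reflection_group.
Proof.
apply/in_reflection_groupP; exists 1%g; first exact: in_torus_closed.1.
by exists w; rewrite mul1g.
Qed.

Definition of_perm w : reflection_group :=
  ReflectionGroup (perm_in_reflection_group w).

Variable k0 : R[i].

Inductive hecke_gen := HE of 'I_n | HT of reflection_group.

Local Notation hterm := (aterm R[i] hecke_gen).
Local Notation e i := (AGen (HE i) : hterm).
Local Notation t_ g := (AGen (HT g) : hterm).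

Definition ktilde (u v : 'I_n) : hterm :=
  let tu := theta_torus u in let tv := theta_torus v in
  ((k0 / 2)%:S *
   \big[@AAdd _ _/0%:S]_(0 <= m < r)
     (t_ (of_torus (tu ^+ m * tv ^- m)%g) +
      t_ (of_torus (tv ^+ m * tu ^- m)%g)))%AT.

(* Adjacent indices i, i+1 are rendered by i' = i.+1 :> nat. *)
Inductive hecke_rel : hterm -> hterm -> Prop :=
| rel_ee i j : hecke_rel (e i * e j) (e j * e i)
| rel_tt g h : hecke_rel (t_ g * t_ h) (t_ (g * h)%g)
| rel_t1 : hecke_rel (t_ 1%g) 1%R%:S
| rel_theta i j :
    hecke_rel (t_ (of_torus (theta_torus i)) * e j)
              (e j * t_ (of_torus (theta_torus i)))
| rel_far (i j j' : 'I_n) :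
    j' = j.+1 :> nat -> i <> j -> i <> j' ->
    hecke_rel (t_ (of_perm (tperm j j')) * e i)
              (e i * t_ (of_perm (tperm j j')))
| rel_near (i i' : 'I_n) :
    i' = i.+1 :> nat ->
    hecke_rel (t_ (of_perm (tperm i i')) * e i)
              (e i' * t_ (of_perm (tperm i i')) + (-1)%R%:S * ktilde i i').

Definition hecke := palg hecke_rel.

HB.instance Definition _ := GRing.PzRing.on hecke.
HB.instance Definition _ := GRing.Lmodule.on hecke.

Definition he (i : 'I_n) : hecke := pcls hecke_rel (e i).
Definition ht (g : reflection_group) : hecke := pcls hecke_rel (t_ g).

(* Nontriviality: e_i |-> i r k0, t_g |-> 1 is a one-dimensional
   representation. *)
Definition trivial_gen (x : hecke_gen) : R[i] :=
  match x with HE i => (i%:R * r%:R * k0)%R | HT _ => 1 end.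

Lemma aeval_ktilde u v : aeval idfun trivial_gen (ktilde u v) = r%:R * k0.
Proof.
rewrite /ktilde /=.
rewrite (@big_morph _ _ (aeval idfun trivial_gen) 0 +%R) //=.
rewrite sumr_const_nat subn0 -[1 + 1]/(2%:R) -[X in _ * X]mulr_natr mulrA.
by rewrite divfK ?pnatr_eq0 // mulrC.
Qed.

Fact hecke_one_neq0 : (1 : hecke) != 0.
Proof.
apply/eqP=> /(congr1 (palg_lift idfun trivial_gen)).
have cent c (s : hterm) : aeval idfun trivial_gen s * (idfun c) =
    idfun c * aeval idfun trivial_gen s by rewrite mulrC.
have frel s t : hecke_rel s t ->
    aeval idfun trivial_gen s = aeval idfun trivial_gen t.
  case=> {s t} [i j|g h||i j|i j j' _ _ _|i i' ii'].
  - exact: mulrC.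
  - exact: mulr1.
  - by [].
  - exact: mulrC.
  - exact: mulrC.
  - move: (ktilde i i') (aeval_ktilde i i') => k /= ->.
    rewrite ii' mul1r mulr1 mulN1r.
    by rewrite -[in RHS]natr1 !mulrDl mul1r addrK.
rewrite -pcls1 -pcls0 !palg_liftE //=.
by apply/eqP; rewrite oner_neq0.
Qed.

HB.instance Definition _ := GRing.PzSemiRing_isNonZero.Build hecke hecke_one_neq0.
HB.instance Definition _ := GRing.Lmodule_isLalgebra.Build R[i] hecke
  (@palg_scaleAl _ _ hecke_rel).
HB.instance Definition _ := GRing.Lalgebra_isAlgebra.Build R[i] hecke
  (@palg_scaleAr _ _ hecke_rel).

(* The presentation of the algebra S(V_0) (x) CT: S(V_0) is the polynomial
   algebra on e_1, ..., e_n, and CT the group algebra. *)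
Inductive comm_gen := CE of 'I_n | CT of torus.

Local Notation cterm := (aterm R[i] comm_gen).
Local Notation ce i := (AGen (CE i) : cterm).
Local Notation ct t := (AGen (CT t) : cterm).

Inductive comm_rel : cterm -> cterm -> Prop :=
| crel_ee i j : comm_rel (ce i * ce j) (ce j * ce i)
| crel_te t i : comm_rel (ct t * ce i) (ce i * ct t)
| crel_tt s t : comm_rel (ct s * ct t) (ct (s * t)%g)
| crel_t1 : comm_rel (ct 1%g) 1%R%:S.

Definition comm_alg := palg comm_rel.

HB.instance Definition _ := GRing.PzRing.on comm_alg.
HB.instance Definition _ := GRing.Lmodule.on comm_alg.

Definition comm_incl_gen (x : comm_gen) : hecke :=
  match x with CE i => he i | CT t => ht (of_torus t) end.

Lemma htM g h : ht g * ht h = ht (g * h)%g.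
Proof. rewrite -pclsM; exact/pclsP/acong_rel/rel_tt. Qed.

Lemma ht1 : ht 1%g = 1.
Proof. rewrite -pcls1; exact/pclsP/acong_rel/rel_t1. Qed.

Lemma heC i j : he i * he j = he j * he i.
Proof. rewrite -!pclsM; exact/pclsP/acong_rel/rel_ee. Qed.

Lemma of_torusM s t : of_torus (s * t)%g = (of_torus s * of_torus t)%g.
Proof. exact/val_inj. Qed.

Lemma of_torus1 : of_torus 1%g = 1%g.
Proof. exact/val_inj. Qed.

Lemma ht_theta_he i j :
  ht (of_torus (theta_torus i)) * he j = he j * ht (of_torus (theta_torus i)).
Proof. rewrite -!pclsM; exact/pclsP/acong_rel/rel_theta. Qed.

Lemma ht_torus_he t j : ht (of_torus t) * he j = he j * ht (of_torus t).
Proof.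
case: t => t tT; move/in_torusP: (tT) => gt.
elim: gt tT => {t} [i||s t gs IHs gt IHt|t gt IHt] tT.
- have -> : Torus tT = theta_torus i by exact/val_inj.
  exact: ht_theta_he.
- have -> : Torus tT = 1%g by exact/val_inj.
  by rewrite of_torus1 ht1 mul1r mulr1.
- have sT : s \in in_torus by exact/in_torusP.
  have tT' : t \in in_torus by exact/in_torusP.
  have -> : Torus tT = (Torus sT * Torus tT')%g by exact/val_inj.
  by rewrite of_torusM -htM -mulrA IHt mulrA IHs mulrA.
- have tT' : t \in in_torus by exact/in_torusP.
  set u := Torus tT; pose v := Torus tT'.
  have uv : ht (of_torus u) * ht (of_torus v) = 1.
    rewrite htM -of_torusM -ht1 -of_torus1; congr (ht (of_torus _)).
    by apply/val_inj; rewrite /= mulVg.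
  have vu : ht (of_torus v) * ht (of_torus u) = 1.
    rewrite htM -of_torusM -ht1 -of_torus1; congr (ht (of_torus _)).
    by apply/val_inj; rewrite /= mulgV.
  rewrite -[LHS]mulr1 -vu mulrA -[_ * he j * _]mulrA -(IHt tT').
  by rewrite [_ * (_ * he j)]mulrA uv mul1r.
Qed.

Fact comm_incl_central c (s : cterm) :
  aeval (in_alg hecke) comm_incl_gen s * in_alg hecke c =
  in_alg hecke c * aeval (in_alg hecke) comm_incl_gen s.
Proof. by rewrite /= mulr_algl mulr_algr. Qed.

Fact comm_incl_rel (s t : cterm) : comm_rel s t ->
  aeval (in_alg hecke) comm_incl_gen s = aeval (in_alg hecke) comm_incl_gen t.
Proof.
case=> {s t} /=.
- exact: heC.
- exact: ht_torus_he.
- by move=> s t; rewrite htM of_torusM.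
- by rewrite of_torus1 ht1 scale1r.
Qed.

Definition comm_incl : {rmorphism comm_alg -> hecke} :=
  palg_liftM comm_incl_central comm_incl_rel.

(* A character T -> C^*; its values are nonzero since T is a group. *)
Record tchar := Tchar {
  tchar_fun :> torus -> R[i];
  tchar1 : tchar_fun 1%g = 1;
  tcharM : forall s t, tchar_fun (s * t)%g = tchar_fun s * tchar_fun t
}.

Definition char_gen (gamma : {scalar 'cV[R[i]]_n}) (mu : tchar)
    (x : comm_gen) : R[i] :=
  match x with CE i => gamma (basis_vec R i) | CT t => mu t end.

Fact char_central gamma mu c (s : cterm) :
  aeval idfun (char_gen gamma mu) s * idfun c =
  idfun c * aeval idfun (char_gen gamma mu) s.
Proof. exact: mulrC. Qed.

Fact char_rel gamma mu (s t : cterm) : comm_rel s t ->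
  aeval idfun (char_gen gamma mu) s = aeval idfun (char_gen gamma mu) t.
Proof.
case=> {s t} /=.
- by move=> i j; rewrite mulrC.
- by move=> t i; rewrite mulrC.
- by move=> s t; rewrite tcharM.
- by rewrite tchar1.
Qed.

(* The character gamma (x) mu. *)
Definition comm_char gamma mu : {rmorphism comm_alg -> R[i]} :=
  palg_liftM (char_central gamma mu) (@char_rel gamma mu).

(* The algebra S(V_0) (x) CT acts on hecke through comm_incl, which maps it
   onto the subalgebra generated by the e_i and T. *)
Definition principal_series gamma mu : lmodType hecke :=
  tensor comm_incl (char_line (comm_char gamma mu)).

Definition dual_act (w : 'S_n) (gamma : {scalar 'cV[R[i]]_n}) :
    {scalar 'cV[R[i]]_n} :=
  gamma \o mulmx (umx (P w)^-1%g).

Fact tchar_act1 w (mu : tchar) : mu (torus_conj w 1%g) = 1.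
Proof. by rewrite torus_conj1 tchar1. Qed.

Fact tchar_actM w (mu : tchar) s t :
  mu (torus_conj w (s * t)%g) = mu (torus_conj w s) * mu (torus_conj w t).
Proof. by rewrite torus_conjM tcharM. Qed.

Definition tchar_act (w : 'S_n) (mu : tchar) : tchar :=
  Tchar (tchar_act1 w mu) (tchar_actM w mu).

Definition tchar_stab (mu : tchar) : {set 'S_n} :=
  [set w | `[< tchar_act w mu =1 mu >]].

Lemma tcharX (mu : tchar) t m : mu (t ^+ m)%g = mu t ^+ m.
Proof. by elim: m => [|m IHm]; rewrite ?tchar1 // expgS tcharM IHm exprS. Qed.

Lemma umx_thetaX i m : umx (theta_torus i ^+ m)%g =
  diag_mx (\row_j (if j == i then xi ^+ m else 1)).
Proof.
elim: m => [|m IHm].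
  rewrite [LHS](_ : _ = 1%:M) // -diag_const_mx; congr diag_mx.
  by apply/rowP=> j; rewrite !mxE expr0 if_same.
rewrite expgS umxM IHm mulmx_diag; congr diag_mx.
by apply/rowP=> j; rewrite !mxE; case: eqP; rewrite ?mulr1 ?exprS.
Qed.

Lemma theta_torusX i : (theta_torus i ^+ r)%g = 1%g.
Proof.
apply/val_inj/val_inj; rewrite /= umx_thetaX (prim_expr_order hxi).
by rewrite -diag_const_mx; congr diag_mx; apply/rowP=> j; rewrite !mxE if_same.
Qed.

Fact tchar_theta_root (varpi : tchar) s : varpi (theta_torus s) ^+ r = 1.
Proof. by rewrite -tcharX theta_torusX tchar1. Qed.

(* varpi_s; its defining property is exponentE. *)
Definition exponent (varpi : tchar) (s : 'I_n) : 'I_r :=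
  sval (prim_rootP hxi (tchar_theta_root varpi s)).

Lemma exponentE (varpi : tchar) s : varpi (theta_torus s) = xi ^+ exponent varpi s.
Proof. by rewrite /exponent; case: prim_rootP. Qed.

Definition multiplicity (varpi : tchar) (j : nat) : nat :=
  #|[set s | exponent varpi s == j :> nat]|.

Definition sorted_exponents (varpi : tchar) : seq nat :=
  flatten [seq nseq (multiplicity varpi j) j | j <- iota 0 r].

(* The character with exponents b : t in T is diagonal, and t s s is its
   eigenvalue on e_s. *)
Definition tchar_of_fun (b : 'I_n -> nat) (t : torus) : R[i] :=
  \prod_(s < n) umx t s s ^+ b s.

Lemma torus_diag (t : torus) : exists d, umx t = diag_mx d.
Proof.
case: t => t /= /in_torusP; elim=> [i||u v _ [d ud] _ [d' vd]|u _ [d ud]].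
- by exists (theta_row i).
- by exists (const_mx 1); rewrite diag_const_mx.
- by rewrite umxM ud vd mulmx_diag; eexists.
- exists (map_mx Num.conj d); rewrite /= invmx_unitary; last by case: (u).
  by rewrite ud tr_diag_mx map_diag_mx.
Qed.

Fact tchar_of1 b : tchar_of_fun b 1%g = 1.
Proof. by apply: big1 => s _; rewrite umx1 mxE eqxx expr1n. Qed.

Fact tchar_ofM b s t :
  tchar_of_fun b (s * t)%g = tchar_of_fun b s * tchar_of_fun b t.
Proof.
rewrite -big_split; apply: eq_bigr => i _ /=; rewrite -exprMn; congr (_ ^+ _).
have [[d sd] [d' td]] := (torus_diag s, torus_diag t).
by rewrite sd td mulmx_diag !mxE eqxx.
Qed.

Definition tchar_of b : tchar := Tchar (tchar_of1 b) (tchar_ofM b).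

Lemma tchar_ofE b s : tchar_of b (theta_torus s) = xi ^+ b s.
Proof.
rewrite /= /tchar_of_fun (bigD1 s) //= big1 ?mulr1 => [|j js].
  by rewrite !mxE !eqxx.
by rewrite !mxE eqxx (negPf js) expr1n.
Qed.

Definition mu_of (varpi : tchar) : tchar :=
  tchar_of (fun s => nth 0%N (sorted_exponents varpi) s).

Definition Pset (varpi : tchar) (gamma : {scalar 'cV[R[i]]_n}) : {set 'S_n} :=
  [set w in tchar_stab (mu_of varpi) |
   [exists i : 'I_n, exists j : 'I_n,
     [&& i != j, w == tperm i j &
       (gamma (basis_vec R i - basis_vec R j) == r%:R * k0) ||
       (gamma (basis_vec R i - basis_vec R j) == - (r%:R * k0))]]].

End ReflectionGroup.

(* The set R(w) of pairs {i, j} with i < j inverted by w. *)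
Definition inversions (n : nat) (w : 'S_n) : {set {set 'I_n}} :=
  [set [set ij.1; ij.2] | ij : 'I_n * 'I_n & (ij.1 < ij.2)%N && (w ij.2 < w ij.1)%N].

(* Main.v *)
From HB Require Import structures.
Require Import Defs.
From mathcomp Require Import all_boot all_order all_fingroup all_algebra.
From mathcomp Require Import generic_quotient complex boolp reals.
From mathcomp Require Import ring zify.

Set Implicit Arguments.
Unset Strict Implicit.
Unset Printing Implicit Defensive.

Import GRing.Theory Num.Theory.

Local Open Scope ring_scope.

(** The idea. Write nu_i for nu(e_i), and call i and j equivalent when varpi
takes the same value on theta_i and theta_j. On a vector of T-weight varpi the
element ktilde_(i,j) acts as the scalar r k_0 if i and j are equivalent, and as
0 otherwise ([char_sum]). All three assertions turn out to be equivalent to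
regularity ([regular_weight]):
   nu_i - nu_j <> r k_0  for all equivalent i <> j.
This condition depends only on the S_n-orbit of (nu, varpi), which gives the
assertion about all w; and conjugating by sigma turns it into the emptiness of
P_varpi, because a transposition (i,j) fixes mu_varpi exactly when mu_varpi
takes the same value on theta_i and theta_j.

Intertwiners. If x is a vector of weight (nu, varpi) and s = (i,i+1), then
   (nu_i - nu_(i+1)) s x + r k_0 x    (i, i+1 equivalent),
   s x                                (otherwise)
has weight s(nu, varpi) ([intertwine]). Applied to the generators of the
principal series of (nu, varpi) and s(nu, varpi) these vectors give maps in
both directions, whose composites are the scalar (r k_0)^2 - (nu_i -
nu_(i+1))^2, respectively 1. Hence simplicity passes from one to the other as
long as this scalar is nonzero ([simple_adjacent]). If it is zero, so that nu_i
- nu_(i+1) = eps r k_0 with eps = 1 or -1, then eps s m + m is a weight vector,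
m being the generator, and it generates a proper nonzero submodule: all of its
elements x satisfy x s = eps x for the right multiplication by s of C[S_n]
([not_simple_adjacent]). Together these facts show that simplicity is a
property of the orbit ([simple_perm]); a bad pair i, j can be moved to adjacent
positions, so simplicity implies regularity ([simple_regular]).

Conversely, let the weight be regular. By the above it may be rearranged so
that equal pairs (nu_i, varpi_i) occupy consecutive positions. A nonzero
submodule contains a weight vector whose weight lies in the orbit of (nu,
varpi), because the e_i act on the basis w m by triangular matrices
([submod_weight]). The intertwiners, which are injective by regularity, carry
it to a nonzero vector of weight (nu, varpi) itself ([weight_vector_move]); and
the vectors of that weight are the multiples of m ([weight_vector_unique]). So
the submodule contains m.

Both halves need the fact that the w m form a basis. It is obtained from an
explicit model of the module on the space of functions on S_n ([model]). There
e_i acts as the difference of an operator that S_n permutes with the index i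
and a Jucys-Murphy element; the relation e_i e_j = e_j e_i is reduced to the
fact that Jucys-Murphy elements commute ([he_op_comm]). *)

(** * Linear endomorphisms and modules defined by representations *)

Section LinearEndomorphisms.
Variables (K : comNzRingType) (V : lmodType K).

(** Linearity is part of the structure because it makes the scalars central, as
the universal property of a presented algebra requires. *)
Record endo := Endo { efun :> V -> V; endo_linear : linear efun }.

HB.instance Definition _ := gen_eqMixin endo.
HB.instance Definition _ := gen_choiceMixin endo.

Lemma endoP (f g : endo) : f =1 g -> f = g.
Proof.
case: f g => f lf [g lg] /= /funext fg; case: g / fg lg => lg.
by congr Endo; exact: Prop_irrelevance.
Qed.

Lemma endo_additive (f : endo) : {morph f : x y / x + y}.
Proof. by move=> x y; rewrite -[x]scale1r (endo_linear f) !scale1r. Qed.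

Lemma endo0 (f : endo) : f 0 = 0.
Proof. by apply: (addIr (f 0)); rewrite -endo_additive !add0r. Qed.

Lemma endoZ (f : endo) c x : f (c *: x) = c *: f x.
Proof. by rewrite -[c *: x]addr0 (endo_linear f) endo0 addr0. Qed.

Fact endo_add_linear (f g : endo) : linear (fun x => f x + g x).
Proof.
by move=> c x y; rewrite !endo_additive !endoZ scalerDr addrACA.
Qed.
Fact endo_opp_linear (f : endo) : linear (fun x => - f x).
Proof. by move=> c x y; rewrite endo_additive endoZ opprD scalerN. Qed.
Fact endo_zero_linear : linear (fun _ : V => 0 : V).
Proof. by move=> c x y; rewrite scaler0 addr0. Qed.
Fact endo_comp_linear (f g : endo) : linear (f \o g).
Proof. by move=> c x y; rewrite /= !endo_additive !endoZ. Qed.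
Fact endo_scal_linear c : linear (fun x : V => c *: x).
Proof. by move=> d x y; rewrite scalerDr !scalerA mulrC. Qed.
Fact endo_id_linear : linear (@id V).
Proof. by []. Qed.

Definition endo_add f g := Endo (endo_add_linear f g).
Definition endo_opp f := Endo (endo_opp_linear f).
Definition endo_zero := Endo endo_zero_linear.
Definition endo_comp f g := Endo (endo_comp_linear f g).
Definition endo_id := Endo endo_id_linear.
Definition endo_scal c := Endo (endo_scal_linear c).

Fact endo_addA : associative endo_add.
Proof. by move=> f g h; apply: endoP => x /=; rewrite addrA. Qed.
Fact endo_addC : commutative endo_add.
Proof. by move=> f g; apply: endoP => x /=; rewrite addrC. Qed.
Fact endo_add0 : left_id endo_zero endo_add.
Proof. by move=> f; apply: endoP => x /=; rewrite add0r. Qed.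
Fact endo_addN : left_inverse endo_zero endo_opp endo_add.
Proof. by move=> f; apply: endoP => x /=; rewrite addNr. Qed.

HB.instance Definition _ :=
  GRing.isZmodule.Build endo endo_addA endo_addC endo_add0 endo_addN.

Fact endo_compA : associative endo_comp.
Proof. by move=> f g h; exact: endoP. Qed.
Fact endo_comp1 : left_id endo_id endo_comp.
Proof. by move=> f; exact: endoP. Qed.
Fact endo_compr1 : right_id endo_id endo_comp.
Proof. by move=> f; exact: endoP. Qed.
Fact endo_compDl : left_distributive endo_comp endo_add.
Proof. by move=> f g h; exact: endoP. Qed.
Fact endo_compDr : right_distributive endo_comp endo_add.
Proof. by move=> f g h; apply: endoP => x; exact: endo_additive. Qed.

HB.instance Definition _ := GRing.Zmodule_isPzRing.Build endo
  endo_compA endo_comp1 endo_compr1 endo_compDl endo_compDr.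

Lemma endoD (f g : endo) x : (f + g) x = f x + g x. Proof. by []. Qed.
Lemma endoM (f g : endo) x : (f * g) x = f (g x). Proof. by []. Qed.

Lemma endo_sum (I : Type) (s : seq I) (P : pred I) (F : I -> endo) x :
  (\sum_(i <- s | P i) F i) x = \sum_(i <- s | P i) F i x.
Proof. by apply: (big_morph (fun f : endo => f x)). Qed.

Fact endo_scal_is_zmod_morphism : zmod_morphism endo_scal.
Proof. by move=> c d; apply: endoP => x; exact: scalerBl. Qed.
Fact endo_scal_is_monoid_morphism : monoid_morphism endo_scal.
Proof.
by split=> [|c d]; apply: endoP => x /=; rewrite ?scale1r ?scalerA.
Qed.

HB.instance Definition _ :=
  GRing.isZmodMorphism.Build K endo endo_scal endo_scal_is_zmod_morphism.
HB.instance Definition _ :=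
  GRing.isMonoidMorphism.Build K endo endo_scal endo_scal_is_monoid_morphism.

Lemma endo_scalC c (f : endo) : f * endo_scal c = endo_scal c * f.
Proof. by apply: endoP => x; exact: endoZ. Qed.

End LinearEndomorphisms.

(** V as an A-module through phi; phi occurs in the type so that one space can
carry several module structures. *)
Definition pullback (K : comNzRingType) (V : lmodType K) (A : pzRingType)
  (phi : {rmorphism A -> endo V}) : Type := V.

Section Pullback.
Variables (K : comNzRingType) (V : lmodType K) (A : pzRingType).
Variable phi : {rmorphism A -> endo V}.
Local Notation W := (pullback phi).

HB.instance Definition _ := GRing.Zmodule.copy W V.

Definition pullback_scale (a : A) (v : W) : W := phi a (v : V).

Fact pullback_scaleA a b v :
  pullback_scale a (pullback_scale b v) = pullback_scale (a * b) v.
Proof. by rewrite /pullback_scale rmorphM. Qed.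
Fact pullback_scale1 : left_id 1 pullback_scale.
Proof. by move=> v; rewrite /pullback_scale rmorph1. Qed.
Fact pullback_scaleDr : right_distributive pullback_scale +%R.
Proof. by move=> a v w; exact: endo_additive. Qed.
Fact pullback_scaleDl v : {morph pullback_scale^~ v : a b / a + b}.
Proof. by move=> a b; rewrite /pullback_scale rmorphD. Qed.

HB.instance Definition _ := GRing.Zmodule_isLmodule.Build A W
  pullback_scaleA pullback_scale1 pullback_scaleDr pullback_scaleDl.

Lemma pullbackE (a : A) (v : W) : a *: v = phi a (v : V) :> V.
Proof. by []. Qed.

End Pullback.

Section SimpleModules.
Variable A : pzRingType.

Lemma simple_iso (M M' : lmodType A) (f : {linear M -> M'})
    (g : {linear M' -> M}) :
  cancel f g -> cancel g f -> simple_module M -> simple_module M'.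
Proof.
move=> fK gK [[v v0] Msimple]; split.
  by exists (f v); apply: contraNneq v0 => fv0; rewrite -(fK v) fv0 linear0.
move=> N [N0 NL]; pose N' := [pred x | f x \in N].
have N'sub : submod_closed N'.
  split=> [|a x y]; rewrite !inE ?linear0 //.
  by move=> fx fy; rewrite linearP; exact: NL.
case: (Msimple N' N'sub) => [N'0|N'T]; [left|right] => y.
  by move=> Ny; rewrite -(gK y) (N'0 (g y)) ?linear0 // inE gK.
by have := N'T (g y); rewrite inE gK.
Qed.

End SimpleModules.

(** * Permutations *)

Section AdjacentTranspositions.
Variable n : nat.
Implicit Types (i j : 'I_n) (u v w : 'S_n).
Local Open Scope group_scope.

(** Adjacent transpositions generate S_n: (i,j) is the conjugate of (i,j-1) by
(j-1,j). *)
Lemma perm_adjacent_ind (P : 'S_n -> Prop) :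
  P 1 ->
  (forall w i i', i' = i.+1 :> nat -> P w -> P (tperm i i' * w)) ->
  forall w, P w.
Proof.
move=> P1 Padj; pose Q u := forall w, P w -> P (u * w).
have QM u v : Q u -> Q v -> Q (u * v).
  by move=> Qu Qv w Pw; rewrite -mulgA; exact/Qu/Qv.
have Qlt d i j : (j = i + d.+1 :> nat)%N -> Q (tperm i j).
  elim: d => [|d IHd] in j *; first by rewrite addn1 => ij w; exact: Padj.
  move=> ij.
  have lt_j' : (i + d.+1 < n)%N.
    by apply: leq_ltn_trans (ltn_ord j); rewrite ij leq_add2l.
  pose j' := Ordinal lt_j'.
  have j'j : j = j'.+1 :> nat by rewrite ij /= addnS.
  have Qj : Q (tperm j' j) by move=> w; exact: Padj.
  have -> : tperm i j = tperm j' j * (tperm i j' * tperm j' j).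
    have -> : tperm i j = tperm i j' ^ tperm j' j.
      rewrite tpermJ tpermL tpermD // -val_eqE /= ?ij.
        by rewrite -[X in _ != X]addn0 eqn_add2l.
      by rewrite -[X in _ != X]addn0 eqn_add2l.
    by rewrite conjgE tpermV mulgA.
  by apply: QM Qj (QM _ _ _ Qj); exact: IHd.
have Qtperm i j : Q (tperm i j).
  wlog lt_ij : i j / (i < j)%N => [Hw|].
    case: (ltngtP i j) => [|ji|/val_inj <-]; [exact: Hw| |].
      by rewrite tpermC; exact: Hw.
    by move=> w; rewrite tperm1 mul1g.
  by apply: (Qlt (j - i).-1); rewrite prednK ?subn_gt0 // subnKC // ltnW.
move=> w; have [ts -> _] := prod_tpermP w.
by elim: ts => [|t ts IH]; rewrite ?big_nil ?big_cons //; exact: Qtperm.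
Qed.

Lemma perm_adjacent_ind_r (P : 'S_n -> Prop) :
  P 1 ->
  (forall w i i', i' = i.+1 :> nat -> P w -> P (w * tperm i i')) ->
  forall w, P w.
Proof.
move=> P1 Padj w; rewrite -[w]invgK.
elim/perm_adjacent_ind: w^-1 => [|v i i' ii' Pv]; first by rewrite invg1.
by rewrite invMg tpermV; exact: Padj.
Qed.

End AdjacentTranspositions.

Section PermutationLevel.
Variable n : nat.
Implicit Types a : 'S_n.

(** By the rearrangement inequality this grows whenever two values that occur
in increasing order are exchanged. It plays the role of the length in the
triangularity argument, being easier to compare. *)
Definition disorder a := (\sum_(p < n) (n - p) * a p)%N.

Lemma disorder_lt a (j k : 'I_n) : (j < k)%N -> (a j < a k)%N ->
  (disorder a < disorder (tperm j k * a))%N.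
Proof.
move=> jk ajk; rewrite /disorder.
have kj : k != j by rewrite -val_eqE /= gtn_eqF.
rewrite (bigD1 j) // (bigD1 k) //= [X in (_ < X)%N](bigD1 j) //=.
rewrite [X in (_ < _ + X)%N](bigD1 k) //= !permM tpermL tpermR.
set S := (X in (_ + (_ + X) < _)%N); set S' := (X in (_ < _ + (_ + X))%N).
have -> : S' = S.
  by apply: eq_bigr => p /andP[pj pk]; rewrite permM tpermD // eq_sym.
have := ltn_ord k; nia.
Qed.

(** An injective refinement of [disorder], that is, a total order on S_n that
extends it. *)
Definition level a := (disorder a * #|'S_n| + enum_rank a)%N.

Lemma level_inj : injective level.
Proof.
move=> a b /(congr1 (modn^~ #|'S_n|)).
by rewrite !modnMDl !modn_small // => /val_inj/enum_rank_inj.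
Qed.

Lemma level_lt a b : (disorder a < disorder b)%N -> (level a < level b)%N.
Proof.
move=> ab; rewrite /level.
apply: (@leq_trans ((disorder a).+1 * #|'S_n|)%N).
  by rewrite mulSn addnC ltn_add2r ltn_ord.
by apply: leq_trans (leq_addr _ _); rewrite leq_mul2r ab orbT.
Qed.

Lemma perm_sorting (key : 'I_n -> nat) : exists u : 'S_n,
  forall p q : 'I_n, (p <= q)%N -> (key (u p) <= key (u q))%N.
Proof.
pose leq_key := relpre key leq; pose s := sort leq_key (ord_tuple n).
have s_perm : perm_eq s (ord_tuple n) by rewrite perm_sort.
have [u sE] := tuple_permP s_perm; exists u => p q pq.
have s_sorted : sorted leq_key s by apply: sort_sorted => x y; exact: leq_total.
have nthE (i : 'I_n) : nth p s i = u i.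
  by rewrite sE -tnth_nth tnth_mktuple tnth_ord_tuple.
have s_size : size s = n by rewrite size_sort size_tuple.
rewrite -(nthE p) -(nthE q).
apply: (sorted_leq_nth _ _ p s_sorted); rewrite ?inE ?s_size //.
  by move=> y x z; exact: leq_trans.
by move=> x; exact: leqnn.
Qed.

End PermutationLevel.


(** * Characters of the torus and weight vectors *)

Section WeightVectors.
Variables (R : realType) (r n : nat) (xi : R[i]).
Variable hxi : r.-primitive_root xi.

Local Notation C := R[i].
Local Notation theta i := (@theta_torus R r n xi hxi i).

Lemma tcharV (mu : tchar n hxi) t : mu t^-1%g = (mu t)^-1.
Proof.
have h : mu t * mu t^-1%g = 1 by rewrite -tcharM mulgV tchar1.
have mut : mu t != 0.
  by apply/eqP=> mu0; move/eqP: h; rewrite mu0 mul0r eq_sym oner_eq0.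
by apply: (mulfI mut); rewrite h divff.
Qed.

Lemma tchar_neq0 (mu : tchar n hxi) t : mu t != 0.
Proof.
apply/eqP=> mu0; have /eqP := tchar1 mu.
by rewrite -(mulgV t) tcharM mu0 mul0r eq_sym oner_eq0.
Qed.

Lemma eq_tchar (mu mu' : tchar n hxi) :
  (forall i, mu (theta i) = mu' (theta i)) -> mu =1 mu'.
Proof.
move=> E [t tT]; move/in_torusP: (tT) => gt.
elim: gt tT => {t} [i||s t gs IHs gt IHt|t gt IHt] tT.
- by have -> : Torus tT = theta i by exact/val_inj.
- have -> : Torus tT = 1%g by exact/val_inj.
  by rewrite !tchar1.
- have sT : s \in in_torus hxi by exact/in_torusP.
  have tT' : t \in in_torus hxi by exact/in_torusP.
  have -> : Torus tT = (Torus sT * Torus tT')%g by exact/val_inj.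
  by rewrite !tcharM IHs IHt.
- have tT' : t \in in_torus hxi by exact/in_torusP.
  have -> : Torus tT = (Torus tT')^-1%g by exact/val_inj.
  by rewrite !tcharV IHt.
Qed.

Lemma torus_conj_theta w i : torus_conj w (theta i) = theta (w^-1%g i).
Proof. by apply/val_inj; rewrite /= theta_conj. Qed.

Lemma torus_conj_comp v w (t : torus n hxi) :
  torus_conj w (torus_conj v t) = torus_conj (w * v) t.
Proof. by apply/val_inj; rewrite /= -conjgM perm_unitaryM. Qed.

Lemma torus_conj_id (t : torus n hxi) : torus_conj 1 t = t.
Proof. by apply/val_inj; rewrite /= perm_unitary1 conjg1. Qed.

Lemma tchar_act_theta w (mu : tchar n hxi) i :
  tchar_act w mu (theta i) = mu (theta (w^-1%g i)).
Proof. by rewrite /= torus_conj_theta. Qed.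

Lemma dual_act_basis w (nu : {scalar 'cV[C]_n}) i :
  dual_act w nu (basis_vec R i) = nu (basis_vec R (w^-1%g i)).
Proof.
rewrite -[LHS]/(nu (umx (perm_unitary R w)^-1%g *m basis_vec R i)).
by rewrite perm_unitaryV perm_unitary_basis.
Qed.

Variable k0 : C.
Local Notation H := (hecke n hxi k0).
Local Notation kappa := (r%:R * k0).
Local Notation hs w := (@ht R r n xi hxi k0 (of_perm hxi w)).
Local Notation hT t := (@ht R r n xi hxi k0 (of_torus t)).
Local Notation "c %:H" := (c%:A : H) (at level 2, format "c %:H").

Lemma hsM v w : hs v * hs w = hs (w * v)%g.
Proof. by rewrite htM; congr ht; apply/val_inj; rewrite /= perm_unitaryM. Qed.

Lemma hs1 : hs 1%g = 1.
Proof.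
by rewrite -(ht1 n hxi k0); congr ht; apply/val_inj; rewrite /= perm_unitary1.
Qed.

Lemma hT_hs t w : hT t * hs w = hs w * hT (torus_conj w t).
Proof.
by rewrite !htM; congr ht; apply/val_inj; rewrite /= -conjgC.
Qed.

Definition same_class (mu : tchar n hxi) i j := mu (theta i) == mu (theta j).

Lemma same_class_act (mu : tchar n hxi) w i j :
  same_class (tchar_act w mu) i j = same_class mu (w^-1%g i) (w^-1%g j).
Proof. by rewrite /same_class !tchar_act_theta. Qed.

Lemma same_class_sym (mu : tchar n hxi) i j :
  same_class mu i j = same_class mu j i.
Proof. exact: eq_sym. Qed.

(** The powers of an r-th root of unity z add up to r if z = 1 and to 0
otherwise; here z is the quotient of the two values of mu. *)
Lemma char_sum (mu : tchar n hxi) u v :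
  k0 / 2 * \sum_(0 <= m < r) (mu (theta u ^+ m * theta v ^- m)%g
                             + mu (theta v ^+ m * theta u ^- m)%g)
  = if same_class mu u v then kappa else 0.
Proof.
pose z := mu (theta u) / mu (theta v).
have zr : z ^+ r = 1.
  by rewrite expr_div_n -!tcharX !theta_torusX !tchar1 divr1.
have S (y : C) : y ^+ r = 1 -> \sum_(0 <= m < r) y ^+ m = (r%:R *+ (y == 1)).
  move=> yr; rewrite big_mkord; case: eqP => [->|/eqP y1].
    rewrite (eq_bigr (fun=> 1)) ?sumr_const ?card_ord // => i _.
    by rewrite expr1n.
  have := subrX1 y r; rewrite yr subrr => /esym/eqP.
  by rewrite mulf_eq0 subr_eq0 (negPf y1) => /eqP.
rewrite (eq_bigr (fun m => z ^+ m + z^-1 ^+ m)); last first.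
  by move=> m _; rewrite !tcharM !tcharV !tcharX invf_div !expr_div_n.
rewrite big_split /= !S ?exprVn ?zr ?invr1 // /same_class invr_eq1.
have -> : (z == 1) = (mu (theta u) == mu (theta v)).
  by rewrite -subr_eq0 -{1}(divff (tchar_neq0 mu (theta v))) -mulrBl mulf_eq0
    invr_eq0 (negPf (tchar_neq0 _ _)) orbF subr_eq0.
case: eqP => _; last by rewrite addr0 mulr0.
rewrite mulr1n -mulr2n -(mulr_natl r%:R 2) mulrA divfK ?pnatr_eq0 //.
exact: mulrC.
Qed.

Definition ktilde_cls (u v : 'I_n) : H := pcls _ (ktilde hxi k0 u v).

Lemma ktilde_clsE u v : ktilde_cls u v = (k0 / 2)%:H *
  \sum_(0 <= m < r) (hT (theta u ^+ m * theta v ^- m)%g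
                   + hT (theta v ^+ m * theta u ^- m)%g).
Proof.
rewrite /ktilde_cls /ktilde pclsM pclsS; congr (_ * _).
rewrite (big_morph (pcls (@hecke_rel R r n xi hxi k0))
  (@pclsD _ _ _) (pcls0 _)).
by apply: eq_bigr => m _; rewrite pclsD.
Qed.

Lemma hs_he_near (i i' : 'I_n) : i' = i.+1 :> nat ->
  hs (tperm i i') * he hxi k0 i
    = he hxi k0 i' * hs (tperm i i') - ktilde_cls i i'.
Proof.
move=> ii'; have /pclsP := acong_rel (rel_near hxi k0 ii').
rewrite /ktilde_cls; move: (ktilde hxi k0 i i') => K.
by rewrite pclsD !pclsM pclsS scaleN1r mulN1r.
Qed.

Lemma hs_he_far (i i' j : 'I_n) : i' = i.+1 :> nat -> j <> i -> j <> i' ->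
  hs (tperm i i') * he hxi k0 j = he hxi k0 j * hs (tperm i i').
Proof.
move=> ii' ji ji'; have /pclsP := acong_rel (rel_far hxi k0 ii' ji ji').
by rewrite !pclsM.
Qed.

Section InModule.
Variable W : lmodType H.

Lemma scalHC (c : C) (a : H) (x : W) : a *: (c%:H *: x) = c%:H *: (a *: x).
Proof. by rewrite !scalerA mulr_algl mulr_algr. Qed.

Lemma scalHA (c d : C) (x : W) : c%:H *: (d%:H *: x) = (c * d)%:H *: x.
Proof. by rewrite scalerA mulr_algl scalerA. Qed.

Lemma scalHD (c d : C) (x : W) : (c + d)%:H *: x = c%:H *: x + d%:H *: x.
Proof. by rewrite scalerDl scalerDl. Qed.

Lemma scalH0 (x : W) : 0%:H *: x = 0.
Proof. by rewrite !scale0r. Qed.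

Lemma scalH1 (x : W) : 1%:H *: x = x.
Proof. by rewrite !scale1r. Qed.

Lemma scalHN (c : C) (x : W) : (- c)%:H *: x = - (c%:H *: x).
Proof. by rewrite !scaleNr. Qed.

Lemma scalH_eq0 (c : C) (x : W) : c != 0 -> c%:H *: x = 0 -> x = 0.
Proof.
move=> c0 /(congr1 (fun y => c^-1%:H *: y)).
by rewrite scalHA mulVf // scalH1 scaler0.
Qed.

Definition tweight (mu : tchar n hxi) (x : W) :=
  forall t, hT t *: x = (mu t)%:H *: x.

Definition eweight (l : 'I_n -> C) (x : W) :=
  forall j, he hxi k0 j *: x = (l j)%:H *: x.

Lemma tweight_act mu x w :
  tweight mu x -> tweight (tchar_act w mu) (hs w *: x).
Proof. by move=> mux t; rewrite scalerA hT_hs -scalerA mux scalHC. Qed.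

Lemma tweight_eq (mu mu' : tchar n hxi) x :
  mu =1 mu' -> tweight mu x -> tweight mu' x.
Proof. by move=> E mux t; rewrite mux E. Qed.

Lemma tweightD mu x y (a b : C) :
  tweight mu x -> tweight mu y -> tweight mu (a%:H *: x + b%:H *: y).
Proof.
move=> mux muy t; rewrite !scalerDr (scalHC a) (scalHC b) mux muy.
by rewrite (scalHC a _ x) (scalHC b _ y).
Qed.

Lemma ktilde_tweight mu x u v : tweight mu x ->
  ktilde_cls u v *: x = (if same_class mu u v then kappa else 0)%:H *: x.
Proof.
move=> mux; rewrite ktilde_clsE -scalerA scaler_suml -(char_sum mu u v).
rewrite -[in RHS]scalHA.
congr (_ *: _); rewrite !scaler_suml; apply: eq_bigr => m _.
by rewrite scalerDl !mux scalHD.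
Qed.

End InModule.
End WeightVectors.

(** * Intertwiners and the universal property of principal series *)

Section Intertwiners.
Variables (R : realType) (r n : nat) (xi : R[i]).
Variable hxi : r.-primitive_root xi.
Local Notation C := R[i].
Local Notation theta i := (@theta_torus R r n xi hxi i).
Variable k0 : C.
Local Notation H := (hecke n hxi k0).
Local Notation kappa := (r%:R * k0).
Local Notation hs w := (@ht R r n xi hxi k0 (of_perm hxi w)).
Local Notation hT t := (@ht R r n xi hxi k0 (of_torus t)).
Local Notation "c %:H" := (c%:A : H) (at level 2, format "c %:H").

(** Every element of G is a product of an element of T and a permutation, so
these may replace the general t_g as generators. *)
Lemma hecke_ind (P : H -> Prop) :
  (forall j, P (he hxi k0 j)) -> (forall t, P (hT t)) ->
  (forall w, P (hs w)) -> (forall c, P (c%:H)) ->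
  (forall a b, P a -> P b -> P (a + b)) ->
  (forall a b, P a -> P b -> P (a * b)) -> forall a, P a.
Proof.
move=> Pe Pt Ps Pc PD PM; elim/pclsW; elim=> [[j|g]|c|s Ps1 t Pt1|s Ps1 t Pt1].
- exact: Pe.
- have /in_reflection_groupP[t tT [w gE]] := valP g.
  have -> : pcls _ (AGen (HT g)) = hT (Torus tT) * hs w.
    by rewrite htM; congr ht; exact/val_inj.
  exact: PM.
- by rewrite pclsS; exact: Pc.
- by rewrite pclsD; exact: PD.
- by rewrite pclsM; exact: PM.
Qed.

Section InModule.
Variable W : lmodType H.
Implicit Types (x : W) (l : 'I_n -> C) (mu : tchar n hxi).

Lemma ktilde_hs mu x i j : tweight mu x ->
  ktilde_cls hxi k0 i j *: (hs (tperm i j) *: x)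
  = (if same_class mu i j then kappa else 0)%:H *: (hs (tperm i j) *: x).
Proof.
move=> mux; rewrite (ktilde_tweight _ _ (tweight_act (tperm i j) mux)).
by rewrite same_class_act tpermV tpermL tpermR same_class_sym.
Qed.

Lemma hs_tpermK x i j : hs (tperm i j) *: (hs (tperm i j) *: x) = x.
Proof. by rewrite scalerA hsM tperm2 hs1 scale1r. Qed.

(** The commutation of e_j with s, evaluated at a vector on which ktilde acts
as a scalar; the two boolean coefficients account for j = i and j = i+1. *)
Lemma he_hs mu x (i i' : 'I_n) : i' = i.+1 :> nat -> tweight mu x ->
  forall j, he hxi k0 j *: (hs (tperm i i') *: x) =
   hs (tperm i i') *: (he hxi k0 (tperm i i' j) *: x)
   + ((j == i')%:R - (j == i)%:R)%:H *:
      ((if same_class mu i i' then kappa else 0)%:H *: x).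
Proof.
move=> ii' mux j; set s := tperm i i'; set c := (if _ then _ else _).
have near (y : W) : hs s *: (he hxi k0 i *: y)
   = he hxi k0 i' *: (hs s *: y) - ktilde_cls hxi k0 i i' *: y.
  by rewrite scalerA hs_he_near // scalerBl -scalerA.
have i'i : (i' == i) = false by rewrite -val_eqE /= ii' gtn_eqF.
have [->|ji] := eqVneq j i.
  rewrite tpermL [i == i']eq_sym i'i sub0r scalHN scalH1.
  apply: (can_inj (fun y : W => hs_tpermK y i i')); rewrite -/s.
  rewrite near hs_tpermK scalerBr hs_tpermK (scalHC c).
  by rewrite (ktilde_hs _ _ mux).
have [->|ji'] := eqVneq j i'.
  by rewrite subr0 scalH1 tpermR near (ktilde_tweight _ _ mux) subrK.
rewrite subrr scalH0 addr0 tpermD 1?eq_sym //.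
by rewrite !scalerA hs_he_far //; exact/eqP.
Qed.

(** The shape of the vector is forced: a s x + b x can only have weight s(l,
mu) if b (l_i - l_(i+1)) = a c, where c is the value of ktilde, and if the
T-weight of x is fixed by s whenever b is nonzero. *)
Lemma intertwine mu l x (i i' : 'I_n) (a b : C) : i' = i.+1 :> nat ->
  tweight mu x -> eweight l x ->
  b * (l i - l i') = a * (if same_class mu i i' then kappa else 0) ->
  b = 0 \/ same_class mu i i' ->
  let s := tperm i i' in let y := a%:H *: (hs s *: x) + b%:H *: x in
  tweight (tchar_act s mu) y /\ eweight (fun j => l (s j)) y.
Proof.
move=> ii' mux lx ab b0 s y; split.
  have sx := tweight_act s mux.
  case: b0 => [b0|same_ii'].
    by move=> t; rewrite /y b0 scalH0 addr0 (scalHC a) sx (scalHC a).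
  apply: tweightD => //; apply: tweight_eq mux; apply: eq_tchar => j.
  rewrite tchar_act_theta tpermV.
  by case: tpermP => [->|->|//]; rewrite (eqP same_ii').
move=> j; rewrite /y !scalerDr (scalHC a) (scalHC b).
rewrite (he_hs ii' mux) !lx (scalHC (l (s j))) scalerDr !scalHA -addrA -scalHD.
congr (_ + _); first by rewrite mulrC.
congr (_%:H *: _); rewrite -mulrA mulrCA -ab.
have i'i : (i' == i) = false by rewrite -val_eqE /= ii' gtn_eqF.
rewrite /s; case: tpermP => [->|->|/eqP/negPf -> /eqP/negPf ->];
  rewrite ?eqxx ?i'i ?(eq_sym i i') ?i'i /=; ring.
Qed.

Definition spanned x y :=
  exists f : 'S_n -> C, y = \sum_w (f w)%:H *: (hs w *: x).

Lemma spannedD x y z : spanned x y -> spanned x z -> spanned x (y + z).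
Proof.
move=> [f ->] [g ->]; exists (fun w => f w + g w).
by rewrite -big_split; apply: eq_bigr => w _; rewrite scalHD.
Qed.

Lemma spannedZ x y c : spanned x y -> spanned x (c%:H *: y).
Proof.
move=> [f ->]; exists (fun w => c * f w).
by rewrite scaler_sumr; apply: eq_bigr => w _; rewrite scalHA.
Qed.

Lemma spanned0 x : spanned x 0.
Proof.
exists (fun=> 0); rewrite big1 // => w _; exact: scalH0.
Qed.

Lemma spanned_hs x w : spanned x (hs w *: x).
Proof.
exists (fun v => (v == w)%:R); rewrite (bigD1 w) //= eqxx scalH1 big1 ?addr0 //.
by move=> v /negPf ->; exact: scalH0.
Qed.

Lemma spanned_linear x (a : H) :
  (forall w, spanned x (a *: (hs w *: x))) ->
  forall y, spanned x y -> spanned x (a *: y).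
Proof.
move=> ax y [f ->]; rewrite scaler_sumr.
apply: big_ind => [|u v|w _]; [exact: spanned0|exact: spannedD|].
by rewrite scalHC; exact/spannedZ/ax.
Qed.

(** On a weight vector the algebra acts through permutations only: moving e_j
through an adjacent transposition creates only multiples of shorter products.
*)
Lemma weight_span mu l x : tweight mu x -> eweight l x ->
  forall a : H, spanned x (a *: x).
Proof.
move=> mux lx.
have Sx : spanned x x.
  by have := spanned_hs x 1; rewrite hs1 scale1r.
suff S (a : H) : forall y, spanned x y -> spanned x (a *: y).
  by move=> a; exact: S.
elim/hecke_ind: a => [j|t|w|c|a b Sa Sb|a b Sa Sb] y; last 3 first.
- by rewrite -[c%:A]mulr1 -scalerA scale1r; exact: spannedZ.
- by move=> Sy; rewrite scalerDl; apply: spannedD; [exact: Sa|exact: Sb].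
- by move=> Sy; rewrite -scalerA; exact/Sa/Sb.
- apply: spanned_linear => w; elim/perm_adjacent_ind_r: w j.
    by move=> j; rewrite hs1 scale1r lx; exact: spannedZ.
  move=> w i i' ii' IH j; rewrite -hsM -scalerA.
  rewrite (he_hs ii' (tweight_act w mux)); apply: spannedD.
    apply: spanned_linear => [v|]; last exact: IH.
    by rewrite scalerA hsM; exact: spanned_hs.
  exact/spannedZ/spannedZ/spanned_hs.
- apply: spanned_linear => w; rewrite (tweight_act w mux).
  exact/spannedZ/spanned_hs.
- by apply: spanned_linear => v; rewrite scalerA hsM; exact: spanned_hs.
Qed.

End InModule.

Section PrincipalSeries.
Variables (nu : {scalar 'cV[C]_n}) (mu : tchar n hxi).
Local Notation M := (principal_series k0 nu mu).
Local Notation incl := (comm_incl n hxi k0).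
Local Notation chi := (comm_char nu mu).

Definition psgen : M := pure incl 1 (1 : char_line chi).
Definition eweights (nu : {scalar 'cV[C]_n}) j := nu (basis_vec R j).

Lemma comm_inclE s :
  incl (pcls _ s) = aeval (in_alg H) (@comm_incl_gen R r n xi hxi k0) s.
Proof.
exact: palg_liftE (@comm_incl_central _ _ _ _ _ _)
  (@comm_incl_rel _ _ _ _ _ _) s.
Qed.

Lemma comm_charE s : chi (pcls _ s) = aeval idfun (char_gen nu mu) s.
Proof.
exact: palg_liftE (@char_central _ _ _ _ _ _ _) (@char_rel _ _ _ _ _ _ _) s.
Qed.

Lemma incl_weight (W : lmodType H) (x : W) :
  tweight mu x -> eweight (eweights nu) x ->
  forall s, incl s *: x = (chi s)%:H *: x.
Proof.
move=> mux nux; elim/pclsW=> s.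
rewrite comm_inclE comm_charE.
elim: s => [[j|t]|c|s IHs t IHt|s IHs t IHt] /=.
- exact: nux.
- exact: mux.
- by [].
- by rewrite scalerDl IHs IHt scalHD.
- by rewrite -scalerA IHt scalHC IHs scalHA mulrC.
Qed.

Lemma psgen_line (c : C) : pure incl 1 (c : char_line chi) = c%:H *: psgen.
Proof.
transitivity (pure incl 1 (pcls _ (AScal c) *: (1 : char_line chi))).
  congr (pure _ _ _).
  by rewrite /GRing.scale /= /char_scale comm_charE /= mulr1.
rewrite -pure_bal scale_pure mul1r mulr1; congr (pure _ _ _).
by rewrite comm_inclE.
Qed.

Lemma pure_psgen a (c : C) :
  pure incl a (c : char_line chi) = (a * c%:H) *: psgen.
Proof. by rewrite -scalerA -psgen_line scale_pure mulr1. Qed.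

Lemma psgen_incl s : incl s *: psgen = (chi s)%:H *: psgen.
Proof.
rewrite -psgen_line scale_pure mulr1 -[incl s]mul1r pure_bal.
by congr (pure _ _ _); rewrite /GRing.scale /= /char_scale mulr1.
Qed.

Lemma psgen_tweight : tweight mu psgen.
Proof.
move=> t; have := psgen_incl (pcls _ (AGen (CT t))).
by rewrite comm_inclE comm_charE.
Qed.

Lemma psgen_eweight : eweight (eweights nu) psgen.
Proof.
move=> j; have := psgen_incl (pcls _ (AGen (CE hxi j))).
by rewrite comm_inclE comm_charE.
Qed.

Lemma ps_cyclic (x : M) : exists a : H, x = a *: psgen.
Proof.
elim/tensor_ind: x => [a c||x [a ->]|x y [a ->] [b ->]].
- by exists (a * c%:H); exact: pure_psgen.
- by exists 0; rewrite scale0r.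
- by exists (- a); rewrite scaleNr.
- by exists (a + b); rewrite scalerDl.
Qed.

Section Universal.
Variables (W : lmodType H) (x : W).
Hypotheses (mux : tweight mu x) (nux : eweight (eweights nu) x).

(** The map a (x) c |-> a c x, defined on formal terms and then shown to
respect the congruence that defines the tensor product. *)
Fixpoint ps_eval (z : tterm H (char_line chi)) : W :=
  match z with
  | TPure a c => (a * (c : C)%:H) *: x
  | TZero => 0
  | TOpp z => - ps_eval z
  | TAdd z z' => ps_eval z + ps_eval z'
  end.

Lemma ps_eval_cong z z' : tcong incl z z' -> ps_eval z = ps_eval z'.
Proof.
elim=> //= {z z'}.
- by move=> z z' z'' _ -> _ ->.
- by move=> z z' _ ->.
- by move=> z z' y y' _ -> _ ->.
- by move=> z z' z''; rewrite addrA.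
- by move=> z z'; rewrite addrC.
- by move=> z; rewrite add0r.
- by move=> z; rewrite addNr.
- by move=> a b v; rewrite mulrDl scalerDl.
- by move=> a v w; rewrite -scalerDl -mulrDr -scalerDl.
- move=> a s v; transitivity (a *: (incl s *: ((v : C)%:H *: x))).
    by rewrite !scalerA.
  rewrite scalHC (incl_weight mux nux) scalHA mulrC [RHS]/=.
  by rewrite -[RHS]scalerA.
Qed.

Definition ps_lift (z : M) : W :=
  ps_eval (repr (z : tensor incl (char_line chi))).

Lemma ps_liftE z : ps_lift (tcls incl z) = ps_eval z.
Proof. exact/ps_eval_cong/repr_tcls. Qed.

Fact ps_lift_linear : linear ps_lift.
Proof.
have D : {morph ps_lift : y z / y + z}.
  elim/tclsW=> y; elim/tclsW=> z.
  have := ps_liftE (TAdd y z); rewrite tclsD => ->.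
  by rewrite /= !ps_liftE.
have Z (a : H) : {morph ps_lift : y / a *: y}.
  elim/tclsW=> y; have := ps_liftE (tact a y); rewrite -tensor_scaleE => ->.
  rewrite ps_liftE.
  elim: y => [b v||y IH|y IHy z IHz] /=.
  - by rewrite -mulrA scalerA.
  - by rewrite scaler0.
  - by rewrite IH scalerN.
  - by rewrite IHy IHz scalerDr.
by move=> a y z; rewrite D Z.
Qed.

(** Frobenius reciprocity: a vector of weight (nu, mu) is the same as a map out
of the principal series. *)
Lemma ps_universal : {f : {linear M -> W} | f psgen = x}.
Proof.
pose f : {linear M -> W} :=
  HB.pack ps_lift (GRing.isLinear.Build H M W *:%R ps_lift ps_lift_linear).
exists f; have := ps_liftE (TPure (1 : H) (1 : char_line chi)).
by rewrite /= mul1r scalH1.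
Qed.

End Universal.
End PrincipalSeries.
End Intertwiners.

(** * The model on functions on the symmetric group *)

(** The basis vector w m corresponds to the indicator function of w^-1.
Indexing by the inverse makes left multiplication by u the operator x(a) |->
x(u a), the product of permutations being composition from left to right. *)
Definition permfun (R : realType) (n : nat) : Type := {ffun 'S_n -> R[i]}.

Section PermFun.
Variables (R : realType) (n : nat).
Local Notation C := R[i].
Local Notation V := (permfun R n).

HB.instance Definition _ := Choice.on V.

Definition val_at (x : V) (a : 'S_n) : C := (x : {ffun 'S_n -> C}) a.
Definition fun_at (f : 'S_n -> C) : V := [ffun a => f a].

Lemma fun_atE f a : val_at (fun_at f) a = f a. Proof. exact: ffunE. Qed.

Lemma permfunP (x y : V) : (forall a, val_at x a = val_at y a) -> x = y.
Proof. by move=> xy; apply/ffunP. Qed.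

Definition permfun_add x y := fun_at (fun a => val_at x a + val_at y a).
Definition permfun_opp x := fun_at (fun a => - val_at x a).
Definition permfun_scale c x := fun_at (fun a => c * val_at x a).

Fact permfun_addA : associative permfun_add.
Proof. by move=> x y z; apply: permfunP => a; rewrite !fun_atE addrA. Qed.
Fact permfun_addC : commutative permfun_add.
Proof. by move=> x y; apply: permfunP => a; rewrite !fun_atE addrC. Qed.
Fact permfun_add0 : left_id (fun_at (fun=> 0)) permfun_add.
Proof. by move=> x; apply: permfunP => a; rewrite !fun_atE add0r. Qed.
Fact permfun_addN : left_inverse (fun_at (fun=> 0)) permfun_opp permfun_add.
Proof. by move=> x; apply: permfunP => a; rewrite !fun_atE addNr. Qed.

HB.instance Definition _ :=
  GRing.isZmodule.Build V permfun_addA permfun_addC permfun_add0 permfun_addN.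

Lemma val_atD x y a : val_at (x + y) a = val_at x a + val_at y a.
Proof. exact: fun_atE. Qed.
Lemma val_at0 a : val_at 0 a = 0.
Proof. exact: fun_atE. Qed.

Fact permfun_scaleA c d x :
  permfun_scale c (permfun_scale d x) = permfun_scale (c * d) x.
Proof. by apply: permfunP => a; rewrite !fun_atE mulrA. Qed.
Fact permfun_scale1 : left_id 1 permfun_scale.
Proof. by move=> x; apply: permfunP => a; rewrite fun_atE mul1r. Qed.
Fact permfun_scaleDr : right_distributive permfun_scale +%R.
Proof.
by move=> c x y; apply: permfunP => a; rewrite !fun_atE mulrDr.
Qed.
Fact permfun_scaleDl x : {morph permfun_scale^~ x : c d / c + d}.
Proof.
by move=> c d; apply: permfunP => a; rewrite !fun_atE mulrDl.
Qed.

HB.instance Definition _ := GRing.Zmodule_isLmodule.Build C V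
  permfun_scaleA permfun_scale1 permfun_scaleDr permfun_scaleDl.

Lemma val_atZ c (x : V) a : val_at (c *: x) a = c * val_at x a.
Proof. exact: fun_atE. Qed.

Lemma val_at_sum (I : Type) (s : seq I) (P : pred I) (F : I -> V) a :
  val_at (\sum_(i <- s | P i) F i) a = \sum_(i <- s | P i) val_at (F i) a.
Proof.
by apply: (big_morph (val_at ^~ a)) => [x y|]; [exact: val_atD|exact: val_at0].
Qed.

Lemma val_endoB (f g : endo V) x a :
  val_at ((f - g) x) a = val_at (f x) a - val_at (g x) a.
Proof. by rewrite endoD val_atD; congr (_ + _); exact: fun_atE. Qed.

End PermFun.

Section ConcreteModule.
Variables (R : realType) (r n : nat) (xi : R[i]).
Variable hxi : r.-primitive_root xi.
Local Notation C := R[i].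
Local Notation theta i := (@theta_torus R r n xi hxi i).
Variable k0 : C.
Local Notation H := (hecke n hxi k0).
Local Notation kappa := (r%:R * k0).
Local Notation hs w := (@ht R r n xi hxi k0 (of_perm hxi w)).
Local Notation hT t := (@ht R r n xi hxi k0 (of_torus t)).
Local Notation "c %:H" := (c%:A : H) (at level 2, format "c %:H").

Local Notation V := (permfun R n).

Variables (l : 'I_n -> C) (mu : tchar n hxi).
Local Notation same := (same_class mu).

Lemma same_trans i j k : same i j -> same i k = same j k.
Proof. by rewrite /same_class => /eqP ->. Qed.

Lemma same_tperm p q i j : same p q -> same (tperm p q i) j = same i j.
Proof. by move=> pq; case: tpermP => // ->; rewrite (same_trans _ pq). Qed.

Fact left_op_linear u :
  linear (fun x : V => fun_at (fun a => val_at x (u * a)%g)).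
Proof.
move=> c x y; apply: permfunP => a /=.
by rewrite !(val_atD, val_atZ, fun_atE).
Qed.
Definition left_op u := Endo (left_op_linear u).

Fact right_op_linear u :
  linear (fun x : V => fun_at (fun a => val_at x (a * u)%g)).
Proof.
move=> c x y; apply: permfunP => a /=.
by rewrite !(val_atD, val_atZ, fun_atE).
Qed.
Definition right_op u := Endo (right_op_linear u).

Fact diag_op_linear (g : 'S_n -> C) :
  linear (fun x : V => fun_at (fun a => g a * val_at x a)).
Proof.
move=> c x y; apply: permfunP => a /=.
rewrite !(val_atD, val_atZ, fun_atE) mulrDr.
by rewrite mulrCA.
Qed.
Definition diag_op g := Endo (diag_op_linear g).

(** A Jucys-Murphy element of the right action, restricted to the
transpositions of equivalent positions and translated by the scalar l_q. *)
Definition right_jm (q : 'I_n) : endo V := endo_scal V (l q) +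
  endo_scal V kappa * \sum_(p < n | (p < q)%N && same p q) right_op (tperm p q).

Fact pointwise_linear (F : 'S_n -> endo V) :
  linear (fun x : V => fun_at (fun a => val_at (F a x) a)).
Proof.
move=> c x y; apply: permfunP => a /=.
by rewrite [LHS]fun_atE (endo_linear (F a)) !(val_atD, val_atZ, fun_atE).
Qed.
Definition pointwise F := Endo (pointwise_linear F).

(** The S_n-equivariant part of e_i: at the basis vector w m it is the
Jucys-Murphy element of the position of i in w, acting on the right. *)
Definition equiv_op i := pointwise (fun a : 'S_n => right_jm (a i)).

Definition jm_term (i j : 'I_n) :=
  diag_op (fun a => if same (a i) (a j) then kappa else 0)
    * left_op (tperm i j).

(** The Jucys-Murphy element of the left action that corrects the equivariance
into the relations of the algebra. *)
Definition left_jm (i : 'I_n) := \sum_(j < n | (i < j)%N) jm_term i j.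

Definition he_op i := equiv_op i - left_jm i.

Lemma left_opE u x a : val_at (left_op u x) a = val_at x (u * a)%g.
Proof. exact: fun_atE. Qed.
Lemma right_opE u x a : val_at (right_op u x) a = val_at x (a * u)%g.
Proof. exact: fun_atE. Qed.
Lemma diag_opE g x a : val_at (diag_op g x) a = g a * val_at x a.
Proof. exact: fun_atE. Qed.
Lemma equiv_opE i x a : val_at (equiv_op i x) a = val_at (right_jm (a i) x) a.
Proof. exact: fun_atE. Qed.
Lemma jm_termE i j x a : val_at (jm_term i j x) a =
  (if same (a i) (a j) then kappa else 0) * val_at x (tperm i j * a)%g.
Proof. by rewrite endoM diag_opE left_opE. Qed.

Lemma right_jmE q x a : val_at (right_jm q x) a = l q * val_at x a +
  kappa * \sum_(p < n | (p < q)%N && same p q) val_at x (a * tperm p q)%g.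
Proof.
rewrite endoD endoM endo_sum val_atD !val_atZ val_at_sum.
by congr (_ + _ * _); apply: eq_bigr => p _; rewrite right_opE.
Qed.

Lemma right_jmDef q : right_jm q = endo_scal V (l q) +
  endo_scal V kappa * \sum_(p < n | (p < q)%N && same p q) right_op (tperm p q).
Proof. by []. Qed.

Local Opaque left_op right_op diag_op right_jm equiv_op.

Lemma left_opM u v : left_op u * left_op v = left_op (v * u)%g.
Proof.
by apply: endoP => x; apply: permfunP => a; rewrite endoM !left_opE mulgA.
Qed.

Lemma left_op1 : left_op 1%g = 1.
Proof. by apply: endoP => x; apply: permfunP => a; rewrite left_opE mul1g. Qed.

Lemma right_opM u v : right_op u * right_op v = right_op (u * v)%g.
Proof.
by apply: endoP => x; apply: permfunP => a; rewrite endoM !right_opE mulgA.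
Qed.

Lemma left_op_equiv_op u i :
  left_op u * equiv_op i = equiv_op (u i) * left_op u.
Proof.
apply: endoP => x; apply: permfunP => a.
rewrite !endoM left_opE !equiv_opE !right_jmE permM left_opE.
by congr (_ + _ * _); apply: eq_bigr => p _; rewrite left_opE mulgA.
Qed.

Lemma left_op_jm_term u i j :
  left_op u * jm_term i j = jm_term (u i) (u j) * left_op u.
Proof.
apply: endoP => x; apply: permfunP => a;
  rewrite !endoM left_opE !diag_opE !left_opE !permM.
by rewrite !mulgA (conjgC (tperm i j)) tpermJ.
Qed.

(** Only transpositions of equivalent positions occur in the operators that
follow, so that multiplication by such a function commutes with all of them. *)
Definition class_invariant (g : 'S_n -> C) :=
  forall a p q, same p q -> g (a * tperm p q)%g = g a.

Lemma diag_op_equiv_op g i : class_invariant g ->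
  diag_op g * equiv_op i = equiv_op i * diag_op g.
Proof.
move=> gI; apply: endoP => x; apply: permfunP => a.
rewrite !endoM diag_opE !equiv_opE !right_jmE mulrDr diag_opE mulrCA;
  congr (_ + _).
rewrite mulrCA; congr (_ * _); rewrite mulr_sumr;
  apply: eq_bigr => p /andP[_ pq].
by rewrite diag_opE gI.
Qed.

Lemma tperm_mulg (i j : 'I_n) (a : 'S_n) :
  (tperm i j * a = a * tperm (a i) (a j))%g.
Proof. by rewrite conjgC tpermJ. Qed.

Lemma diag_op_jm_term g i j : class_invariant g ->
  diag_op g * jm_term i j = jm_term i j * diag_op g.
Proof.
move=> gI; apply: endoP => x; apply: permfunP => a.
rewrite !endoM !diag_opE !left_opE diag_opE mulrCA; case: ifP => ij;
  last by rewrite !mul0r.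
by congr (_ * (_ * _)); rewrite tperm_mulg gI.
Qed.

Lemma same_invariant i j :
  class_invariant (fun a : 'S_n => if same (a i) (a j) then kappa else 0).
Proof.
by move=> a p q pq; rewrite !permM same_tperm // (same_class_sym mu)
  same_tperm // (same_class_sym mu).
Qed.

Lemma theta_invariant i : class_invariant (fun a => mu (theta (a i))).
Proof.
by move=> a p q pq; rewrite permM; case: tpermP => // ->; rewrite (eqP pq).
Qed.

Lemma diag_op_he_op g i : class_invariant g ->
  diag_op g * he_op i = he_op i * diag_op g.
Proof.
move=> gI; rewrite mulrBr mulrBl diag_op_equiv_op //; congr (_ - _).
by rewrite mulr_sumr mulr_suml; apply: eq_bigr => j _; exact: diag_op_jm_term.
Qed.

Lemma jm_term_equiv_op i j k :
  jm_term i j * equiv_op k = equiv_op (tperm i j k) * jm_term i j.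
Proof.
rewrite -mulrA left_op_equiv_op !mulrA; congr (_ * _).
exact/diag_op_equiv_op/same_invariant.
Qed.

Lemma jm_term_jm_term i j k m : jm_term i j * jm_term k m =
  jm_term (tperm i j k) (tperm i j m) * jm_term i j.
Proof.
rewrite -[LHS]mulrA left_op_jm_term [RHS]mulrA [LHS]mulrA; congr (_ * _).
exact/diag_op_jm_term/same_invariant.
Qed.

Lemma jm_term_sym i j : jm_term i j = jm_term j i.
Proof.
by apply: endoP => x; apply: permfunP => a;
  rewrite !jm_termE (same_class_sym mu) tpermC.
Qed.

(** For p < q the element of q is invariant under conjugation by the
transpositions (p',p) with p' < p, which permute the positions below q. *)
Lemma right_jm_comm p q : right_jm p * right_jm q = right_jm q * right_jm p.
Proof.
wlog lt_pq : p q / (p < q)%N => [Hw|].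
  by case: (ltngtP p q) => [|qp|/val_inj -> //]; [exact: Hw|exact/esym/Hw].
rewrite [right_jm p]right_jmDef mulrDl [RHS]mulrDr [in RHS]endo_scalC;
  congr (_ + _).
rewrite -mulrA [RHS]mulrA endo_scalC -mulrA; congr (_ * _).
rewrite mulr_suml mulr_sumr; apply: eq_bigr => p' /andP[p'p same_p'p].
rewrite right_jmDef mulrDr mulrDl endo_scalC; congr (_ + _).
rewrite mulrA endo_scalC -!mulrA; congr (_ * _).
rewrite mulr_suml mulr_sumr.
rewrite [RHS](reindex_inj (@perm_inj _ (tperm p' p))) /=.
apply: eq_big => [k|k _].
  rewrite same_tperm // andbC [RHS]andbC; congr (_ && _).
  have p'q := ltn_trans p'p lt_pq.
  by case: tpermP => // ->; rewrite ?lt_pq ?p'q.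
rewrite !right_opM; congr right_op; rewrite [LHS]conjgCV tpermV;
  congr (_ * _)%g.
rewrite tpermJ (_ : tperm p' p q = q) // tpermD // -val_eqE /= ltn_eqF //.
exact: ltn_trans lt_pq.
Qed.

(** The outer operator acts at the position of i after a transposition (p, a
i). This leaves the position of j in place, except for p = a j, when it becomes
the old position of i: hence the correction term. *)
Lemma equiv_op_equiv_op i j x a : i != j ->
  val_at (equiv_op i (equiv_op j x)) a
    = val_at (right_jm (a i) (right_jm (a j) x)) a +
    (if (a j < a i)%N && same (a j) (a i) then kappa else 0) *
      (val_at (right_jm (a i) x) (tperm i j * a)%g
       - val_at (right_jm (a j) x) (tperm i j * a)%g).
Proof.
move=> ij; rewrite equiv_opE (right_jmE _ (equiv_op j x)).
rewrite (right_jmE _ (right_jm (a j) x)) equiv_opE -addrA; congr (_ + _).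
have aij : a i != a j by rewrite (inj_eq perm_inj).
have Zterm p : p != a j ->
    val_at (equiv_op j x) (a * tperm p (a i))%g
    = val_at (right_jm (a j) x) (a * tperm p (a i))%g.
  by move=> paj; rewrite equiv_opE permM tpermD.
case: ifP => Paj; last first.
  rewrite mul0r addr0; congr (_ * _); apply: eq_bigr => p Pp; apply: Zterm.
  by apply: contraTneq Pp => ->; rewrite Paj.
rewrite !(bigD1 (a j) Paj) /= -mulrDr; congr (_ * _).
rewrite equiv_opE permM tpermL tperm_mulg [tperm (a i) _]tpermC.
rewrite (eq_bigr _ (fun p Pp => Zterm p (proj2 (andP Pp)))).
by ring.
Qed.

(** The right Jucys-Murphy elements commute, so only the correction terms
remain; exactly one of the two orders of i and j contributes. *)
Lemma equiv_op_commutator i j : i != j ->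
  equiv_op i * equiv_op j - equiv_op j * equiv_op i
    = jm_term i j * (equiv_op j - equiv_op i).
Proof.
move=> ij; apply: endoP => x; apply: permfunP => a.
rewrite val_endoB !endoM !equiv_op_equiv_op // 1?eq_sym //.
rewrite -endoM right_jm_comm endoM [tperm j i]tpermC opprD addrACA subrr add0r.
rewrite diag_opE left_opE val_endoB !equiv_opE !permM tpermL tpermR.
rewrite -mulrN opprB -mulrDl; congr (_ * _).
have aij : a i != a j :> nat by rewrite val_eqE (inj_eq perm_inj).
rewrite (same_class_sym mu (a j)); case: (same _ _);
  rewrite ?andbF ?andbT ?addr0 //.
by case: ltngtP aij => // _ _; rewrite ?addr0 ?add0r.
Qed.

(** All terms but that of j commute with the equivariant operator of j. *)
Lemma left_jm_equiv_op (i j : 'I_n) : (i < j)%N ->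
  left_jm i * equiv_op j - equiv_op j * left_jm i
    = jm_term i j * (equiv_op j - equiv_op i).
Proof.
move=> ij; rewrite /left_jm (bigD1 j) //= mulrDl !mulrDr mulrN.
have -> : jm_term i j * equiv_op i = equiv_op j * jm_term i j.
  by rewrite jm_term_equiv_op tpermL.
rewrite opprD addrACA [X in _ + X](_ : _ = 0) ?addr0 //.
apply/eqP; rewrite subr_eq0; apply/eqP.
rewrite mulr_suml mulr_sumr; apply: eq_bigr => k /andP[ik kj].
by rewrite jm_term_equiv_op tpermD // -val_eqE /= ltn_eqF.
Qed.

Lemma equiv_op_left_jm (i j : 'I_n) : (i < j)%N ->
  equiv_op i * left_jm j = left_jm j * equiv_op i.
Proof.
move=> ij; rewrite mulr_suml mulr_sumr; apply: eq_bigr => k jk.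
by rewrite jm_term_equiv_op tpermD // -val_eqE /= gtn_eqF // (ltn_trans ij).
Qed.

Lemma left_jm_comm (i j : 'I_n) : (i < j)%N ->
  left_jm i * left_jm j = left_jm j * left_jm i.
Proof.
move=> ij; rewrite [in LHS]/left_jm mulr_sumr.
rewrite [RHS]mulr_suml; apply: eq_bigr => k jk.
rewrite mulr_suml mulr_sumr [LHS](reindex_inj (@perm_inj _ (tperm j k))) /=.
have ik := ltn_trans ij jk.
apply: eq_big => [m|m _].
  by case: tpermP => // ->; rewrite ij ik.
by rewrite [RHS]jm_term_jm_term (tpermD (z := i)) // -val_eqE /= gtn_eqF.
Qed.

(** The commutator of the equivariant parts cancels the one cross term that
does not vanish. *)
Lemma he_op_comm (i j : 'I_n) : he_op i * he_op j = he_op j * he_op i.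
Proof.
wlog ij : i j / (i < j)%N => [Hw|].
  by case: (ltngtP i j) => [|ji|/val_inj -> //]; [exact: Hw|exact/esym/Hw].
have Zc : equiv_op i * equiv_op j
  = jm_term i j * (equiv_op j - equiv_op i) + equiv_op j * equiv_op i.
  by rewrite -equiv_op_commutator ?subrK // -val_eqE /= ltn_eqF.
have Jc : left_jm i * equiv_op j
  = jm_term i j * (equiv_op j - equiv_op i) + equiv_op j * left_jm i.
  by rewrite -left_jm_equiv_op ?subrK.
rewrite !mulrBl !mulrBr Zc Jc (equiv_op_left_jm ij) (left_jm_comm ij).
rewrite !opprD !opprK !addrA; set f := jm_term i j * _.
congr (_ + _); rewrite -[f + _ - _]addrA [f + _]addrC addrK.
exact: addrAC.
Qed.

Definition torus_op (t : torus n hxi) :=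
  diag_op (fun a => mu (torus_conj a^-1%g t)).

Lemma torus_opE t x a :
  val_at (torus_op t x) a = mu (torus_conj a^-1%g t) * val_at x a.
Proof. exact: diag_opE. Qed.

Lemma torus_opM s t : torus_op s * torus_op t = torus_op (s * t)%g.
Proof.
apply: endoP => x; apply: permfunP => a.
by rewrite endoM !torus_opE torus_conjM tcharM mulrA.
Qed.

Lemma torus_op1 : torus_op 1%g = 1.
Proof.
by apply: endoP => x; apply: permfunP => a;
  rewrite torus_opE torus_conj1 tchar1 mul1r.
Qed.

Lemma left_op_torus_op w t :
  left_op w * torus_op t = torus_op (torus_conj w^-1%g t) * left_op w.
Proof.
apply: endoP => x; apply: permfunP => a.
by rewrite !endoM left_opE !torus_opE left_opE torus_conj_comp invMg.
Qed.

Lemma perm_unitary_diag (w : 'S_n) (d : 'rV[C]_n) :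
  umx (perm_unitary R w) = diag_mx d -> w = 1%g.
Proof.
move=> wd; apply/permP => j; rewrite perm1; apply/eqP.
have /matrixP/(_ (w j) j) := wd; rewrite !mxE eqxx.
by case: eqP => // _ /eqP; rewrite mulr0n oner_eq0.
Qed.

(** A permutation matrix that is diagonal is the identity, so T and S_n meet
trivially. *)
Lemma refl_decomp_uniq (t t' : torus n hxi) w w' :
  (Defs.tval t * perm_unitary R w = Defs.tval t' * perm_unitary R w')%g ->
  t = t' /\ w = w'.
Proof.
move=> E; have ww' : w = w'.
  have tt' : ((Defs.tval t')^-1 * Defs.tval t)%g = perm_unitary R (w^-1 * w').
    apply: (mulIg (perm_unitary R w)).
    by rewrite -mulgA E mulKg perm_unitaryM mulKVg.
  have [d td] := torus_diag (t'^-1 * t)%g.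
  have := perm_unitary_diag (etrans (congr1 (@umx R n) (esym tt')) td).
  by move/(canRL (mulKg _)); rewrite invgK mulg1.
by move: E; rewrite ww' => /mulIg/val_inj.
Qed.

Lemma refl_decomp (g : reflection_group n hxi) :
  exists tw : torus n hxi * 'S_n,
    Defs.gval g = (Defs.tval tw.1 * perm_unitary R tw.2)%g.
Proof.
have /in_reflection_groupP[t tT [w gE]] := valP g.
by exists (Torus tT, w).
Qed.

Definition group_op (g : reflection_group n hxi) : endo V :=
  let tw := sval (cid (refl_decomp g)) in torus_op tw.1 * left_op tw.2.

Lemma group_opE (g : reflection_group n hxi) (t : torus n hxi) w :
  Defs.gval g = (Defs.tval t * perm_unitary R w)%g ->
    group_op g = torus_op t * left_op w.
Proof.
rewrite /group_op; case: cid => [[t' w'] /= ->].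
by move/refl_decomp_uniq => [-> ->].
Qed.

Lemma group_op_torus t : group_op (of_torus t) = torus_op t.
Proof.
rewrite (group_opE (t := t) (w := 1%g)) ?left_op1 ?mulr1 //.
by rewrite perm_unitary1 mulg1.
Qed.

Lemma group_op_perm w : group_op (of_perm hxi w) = left_op w.
Proof.
by rewrite (group_opE (t := 1%g) (w := w)) ?torus_op1 ?mul1r // mul1g.
Qed.

Lemma group_opM g h : group_op g * group_op h = group_op (g * h)%g.
Proof.
have [[t w] /= gE] := refl_decomp g; have [[t' w'] /= hE] := refl_decomp h.
rewrite (group_opE gE) (group_opE hE).
rewrite (@group_opE _ (t * torus_conj w^-1 t')%g (w' * w)%g).
  rewrite mulrA -[_ * _ * torus_op t']mulrA left_op_torus_op.
  by rewrite -torus_opM -left_opM !mulrA.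
rewrite /= gE hE -perm_unitaryM -!mulgA; congr (_ * _)%g.
by rewrite -perm_unitaryV invgK mulKg.
Qed.

Definition hecke_op (x : hecke_gen n hxi) : endo V :=
  match x with HE i => he_op i | HT g => group_op g end.

Local Notation ev := (aeval (endo_scal V) hecke_op).

Definition same_op (i j : 'I_n) : endo V :=
  diag_op (fun a => if same (a i) (a j) then kappa else 0).

Lemma eval_ktilde i j : ev (ktilde hxi k0 i j) = same_op i j.
Proof.
rewrite /ktilde /=.
rewrite (@big_morph _ _ ev 0 +%R) //=; last first.
  by apply: endoP => x; exact: scale0r.
apply: endoP => x; apply: permfunP => a.
rewrite endoM endo_sum val_atZ val_at_sum [RHS]diag_opE.
rewrite -[X in (if X then _ else _)]/(same_class mu (a i) (a j)).
have -> : same (a i) (a j) = same_class (tchar_act a^-1 mu) i j.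
  by rewrite same_class_act invgK.
rewrite -char_sum -mulrA; congr (_ * _); rewrite mulr_suml.
by apply: eq_bigr => m _;
  rewrite !group_op_torus endoD val_atD !torus_opE mulrDl.
Qed.

Lemma adjacent_lt (i i' j : 'I_n) : i' = i.+1 :> nat ->
  (i < j)%N -> j != i' -> (i' < j)%N.
Proof.
by move=> ii' ij ji'; rewrite ltn_neqAle {2}ii' ij andbT val_eqE eq_sym.
Qed.

Lemma left_op_he_op_near (i i' : 'I_n) : i' = i.+1 :> nat ->
  left_op (tperm i i') * he_op i
    = he_op i' * left_op (tperm i i') - same_op i i'.
Proof.
move=> ii'; set s := tperm i i'.
have lt_ii' : (i < i')%N by rewrite ii'.
rewrite mulrBr mulrBl left_op_equiv_op tpermL -addrA; congr (_ + _);
  rewrite -opprD.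
congr (- _); rewrite /left_jm (bigD1 i') //= mulrDr addrC left_op_jm_term
  tpermL tpermR.
congr (_ + _).
  rewrite mulr_suml mulr_sumr; apply: eq_big => [j|j /andP[ij ji']].
    apply/andP/idP => [[ij ji']|i'j]; first exact: adjacent_lt ij ji'.
    by split; [exact: ltn_trans i'j|rewrite -val_eqE /= gtn_eqF].
  by rewrite left_op_jm_term tpermL tpermD // 1?eq_sym // -val_eqE /= gtn_eqF.
by rewrite jm_term_sym -mulrA left_opM tperm2 left_op1 mulr1.
Qed.

Lemma left_op_he_op_far (i i' j : 'I_n) :
  i' = i.+1 :> nat -> j <> i -> j <> i' ->
  left_op (tperm i i') * he_op j = he_op j * left_op (tperm i i').
Proof.
move=> ii' /eqP ji /eqP ji'; set s := tperm i i'.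
have sj : s j = j by rewrite tpermD // eq_sym.
rewrite mulrBr mulrBl left_op_equiv_op sj; congr (_ - _).
rewrite mulr_suml mulr_sumr [RHS](reindex_inj (@perm_inj _ s)) /=.
apply: eq_big => [k|k _]; last by rewrite left_op_jm_term sj.
have lt_ii' : (i < i')%N by rewrite ii'.
rewrite /s; case: tpermP => // ->.
  apply/idP/idP => [jk|]; first exact: ltn_trans jk lt_ii'.
  by rewrite ii' ltnS leq_eqVlt val_eqE (negPf ji).
apply/idP/idP => [|jk]; last exact: ltn_trans jk lt_ii'.
by rewrite ii' ltnS leq_eqVlt val_eqE (negPf ji).
Qed.

Fact hecke_op_central c s : ev s * endo_scal V c = endo_scal V c * ev s.
Proof. exact: endo_scalC. Qed.

Fact hecke_op_rel s t : hecke_rel k0 s t -> ev s = ev t.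
Proof.
case=> {s t} [i j|g h||i j|i j j' jj' ij ij'|i i' ii'].
- exact: he_op_comm.
- exact: group_opM.
- rewrite /= -[1%g](_ : of_torus 1%g = _) ?group_op_torus ?torus_op1;
  last exact: val_inj.
  by apply: endoP => x; rewrite /= scale1r.
- rewrite /= group_op_torus; apply: diag_op_he_op => a p q pq.
  rewrite !torus_conj_theta !invgK; exact: theta_invariant.
- by rewrite /= group_op_perm; exact: left_op_he_op_far.
- have := eval_ktilde i i'; move: (ktilde _ _ _ _) => K /= ->.
  rewrite group_op_perm left_op_he_op_near //; congr (_ + _).
  by apply: endoP => x; rewrite /= scaleN1r.
Qed.

Definition model_rep : {rmorphism H -> endo V} :=
  palg_liftM hecke_op_central hecke_op_rel.

(** The representation on functions, as a module; the principal series is shown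
to be isomorphic to it. *)
Definition model : lmodType H := pullback model_rep.

Lemma model_repE s : model_rep (pcls _ s) = ev s.
Proof. exact: palg_liftE hecke_op_central hecke_op_rel s. Qed.

Lemma model_he j (x : model) : he hxi k0 j *: x = he_op j x :> V.
Proof. by rewrite pullbackE model_repE. Qed.
Lemma model_hs w (x : model) : hs w *: x = left_op w x :> V.
Proof. by rewrite pullbackE model_repE -group_op_perm. Qed.
Lemma model_hT t (x : model) : hT t *: x = torus_op t x :> V.
Proof. by rewrite pullbackE model_repE -group_op_torus. Qed.
Lemma model_scal c (x : model) : c%:H *: x = c *: (x : V) :> V.
Proof. by rewrite pullbackE -[c%:A]pclsS model_repE. Qed.

End ConcreteModule.

(** * The principal series is isomorphic to the model *)

Section ModelFormulas.
Variables (R : realType) (r n : nat) (xi : R[i]).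
Variable hxi : r.-primitive_root xi.
Local Notation C := R[i].
Local Notation theta i := (@theta_torus R r n xi hxi i).
Variable k0 : C.
Local Notation H := (hecke n hxi k0).
Local Notation kappa := (r%:R * k0).
Local Notation hs w := (@ht R r n xi hxi k0 (of_perm hxi w)).
Local Notation hT t := (@ht R r n xi hxi k0 (of_torus t)).
Local Notation "c %:H" := (c%:A : H) (at level 2, format "c %:H").

Section OneWeight.
Variables (l : 'I_n -> C) (mu : tchar n hxi).
Local Notation same := (same_class mu).
Local Notation V := (permfun R n).
Local Notation E := (he_op k0 l mu).
Local Notation left_op := (left_op R).

(** Both Jucys-Murphy parts together: the term of k survives only if a
preserves the order of j and k, so that tperm j k * a reverses it. *)
Lemma he_opE j x a : val_at (E j x) a = l (a j) * val_at x a +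
  kappa * \sum_(k < n | same (a j) (a k))
    ((a k < a j)%N%:R - (j < k)%N%:R) * val_at x (tperm j k * a)%g.
Proof.
rewrite val_endoB equiv_opE right_jmE endo_sum val_at_sum -addrA; congr (_ + _).
under [X in _ = _ * X]eq_bigr do rewrite mulrBl.
rewrite sumrB mulrBr; congr (_ - _).
  congr (_ * _); rewrite (reindex_inj (@perm_inj _ a)) /= [LHS]big_mkcond.
  rewrite [RHS]big_mkcond; apply: eq_bigr => k _.
  rewrite (same_class_sym mu (a k)) [(tperm j k * a)%g]tperm_mulg.
  rewrite [tperm (a j) _]tpermC.
  by case: ltnP; case: (same _ _); rewrite ?mul1r ?mul0r.
rewrite mulr_sumr [LHS]big_mkcond [RHS]big_mkcond; apply: eq_bigr => k _.
rewrite jm_termE; case: ltnP; case: (same _ _) => _;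
  by rewrite ?mul1r ?mul0r ?mulr0.
Qed.

Definition dirac1 : V := fun_at (fun a => (a == 1%g)%:R).

Lemma dirac1E a : val_at dirac1 a = (a == 1%g)%:R.
Proof. exact: fun_atE. Qed.

Lemma left_op_dirac1 w a : val_at (left_op w dirac1) a = (a == w^-1%g)%:R.
Proof.
rewrite left_opE dirac1E; congr (nat_of_bool _)%:R.
by rewrite -[RHS](inj_eq (mulgI w)) mulgV.
Qed.

Local Notation M := (model k0 l mu).

Lemma dirac1_tweight : tweight mu (dirac1 : M).
Proof.
move=> t; rewrite model_hT model_scal; apply: permfunP => a.
rewrite torus_opE val_atZ dirac1E; case: eqP => [->|_]; last by rewrite !mulr0.
by rewrite invg1 torus_conj_id.
Qed.

Lemma dirac1_eweight : eweight l (dirac1 : M).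
Proof.
move=> j; rewrite model_he model_scal; apply: permfunP => a.
rewrite he_opE val_atZ dirac1E [X in _ + _ * X]big1 => [|k _].
  by rewrite mulr0 addr0; case: eqP => [->|_]; rewrite ?mulr0 ?perm1.
rewrite dirac1E; case: eqP => [/(canRL (tpermKg j k))|_]; last by rewrite mulr0.
by rewrite mulg1 => ->; rewrite tpermL tpermR subrr mul0r.
Qed.

Lemma model_sum (I : Type) (s : seq I) (P : pred I) (F : I -> M) a :
  val_at (\sum_(i <- s | P i) F i) a = \sum_(i <- s | P i) val_at (F i) a.
Proof. exact: val_at_sum. Qed.

Lemma model_combE (f : 'S_n -> C) a :
  val_at (\sum_w (f w)%:H *: (hs w *: (dirac1 : M))) a = f a^-1%g.
Proof.
rewrite model_sum (bigD1 a^-1%g) //= big1 => [|w wa].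
  by rewrite addr0 model_scal val_atZ model_hs left_op_dirac1 invgK eqxx mulr1.
rewrite model_scal val_atZ model_hs left_op_dirac1 eq_sym.
by rewrite (canF_eq invgK) (negPf wa) mulr0.
Qed.

Lemma model_span (x : M) :
  x = \sum_w (val_at x w^-1%g)%:H *: (hs w *: (dirac1 : M)).
Proof. by apply: permfunP => a; rewrite model_combE invgK. Qed.

End OneWeight.

Section PrincipalSeriesModel.
Variables (nu : {scalar 'cV[C]_n}) (mu : tchar n hxi).
Local Notation M := (principal_series k0 nu mu).
Local Notation MV := (model k0 (eweights nu) mu).
Local Notation m := (psgen k0 nu mu).

(** The map that sends the generator to the indicator function of 1 sends the
spanning vectors w m to a basis. *)
Lemma ps_model_bijective : exists (f : {linear M -> MV}) (g : {linear MV -> M}),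
  [/\ cancel f g, cancel g f & f m = dirac1].
Proof.
have [f fm] := ps_universal (dirac1_tweight (eweights nu) mu)
  (dirac1_eweight (eweights nu) mu).
have fcomb (c : 'S_n -> C) : f (\sum_w (c w)%:H *: (hs w *: m))
    = \sum_w (c w)%:H *: (hs w *: (dirac1 : MV)).
  by rewrite linear_sum; apply: eq_bigr => w _; rewrite !linearZ /= fm.
pose g (y : MV) : M := \sum_w (val_at y w^-1%g)%:H *: (hs w *: m).
have gK : cancel g f by move=> y; rewrite fcomb -model_span.
have fK : cancel f g.
  move=> x; have [a ->] := ps_cyclic x.
  have [c ->] := weight_span (@psgen_tweight _ _ _ _ _ k0 nu mu)
    (@psgen_eweight _ _ _ _ _ k0 nu mu) a.
  by rewrite fcomb; apply: eq_bigr => w _; rewrite model_combE invgK.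
have g_lin : linear g.
  by move=> a x y; rewrite -[RHS]fK linearP !gK.
pose g' : {linear MV -> M} :=
  HB.pack g (GRing.isLinear.Build H MV M *:%R g g_lin).
by exists f, g'.
Qed.

End PrincipalSeriesModel.

Section MapsBetweenPrincipalSeries.

Lemma ps_linear_ext (nu : {scalar 'cV[C]_n}) (mu : tchar n hxi) (W : lmodType H)
    (f g : {linear principal_series k0 nu mu -> W}) :
  f (psgen k0 nu mu) = g (psgen k0 nu mu) -> f =1 g.
Proof. by move=> fg x; have [a ->] := ps_cyclic x; rewrite !linearZ fg. Qed.

(** Two maps between principal series whose composites are one nonzero scalar
d: after division by d they are mutually inverse. *)
Lemma simple_exchange (nu nu' : {scalar 'cV[C]_n}) (mu mu' : tchar n hxi)
    (s : 'S_n) (a b a' b' : C) :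
  let m := psgen k0 nu mu in let m' := psgen k0 nu' mu' in
  let y := a%:H *: (hs s *: m) + b%:H *: m in
  let y' := a'%:H *: (hs s *: m') + b'%:H *: m' in
  (s * s = 1)%g ->
  tweight mu' y -> eweight (eweights nu') y ->
  tweight mu y' -> eweight (eweights nu) y' ->
  a * a' + b * b' != 0 -> a * b' + b * a' = 0 ->
  simple_module (principal_series k0 nu mu) ->
  simple_module (principal_series k0 nu' mu').
Proof.
move=> m m' y y' ss mu'y nu'y muy' nuy' d0 cross.
have [f fm] := ps_universal muy' nuy'.
have [g gm'] := ps_universal mu'y nu'y.
set d := a * a' + b * b' in d0.
have comp (W : lmodType H) (c1 c2 c3 c4 : C) (x : W) :
    c3%:H *: (hs s *: (c1%:H *: (hs s *: x) + c2%:H *: x))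
    + c4%:H *: (c1%:H *: (hs s *: x) + c2%:H *: x)
    = (c3 * c1 + c4 * c2)%:H *: x + (c3 * c2 + c4 * c1)%:H *: (hs s *: x).
  rewrite !scalerDr (scalHC c1) (scalHC c2) !scalHA.
  rewrite [hs s *: (hs s *: x)]scalerA.
  rewrite hsM ss hs1 scale1r [X in _ + _ + X]addrC addrACA.
  by rewrite -!scalHD.
have fy : f y = d%:H *: m'.
  rewrite linearD !linearZ /= fm comp.
  by rewrite [X in X%:H *: (hs s *: _)]cross scalH0 addr0.
have gy' : g y' = d%:H *: m.
  rewrite linearD !linearZ /= gm' comp.
  rewrite [a' * b + _]addrC [b' * a]mulrC [a' * b]mulrC cross scalH0 addr0.
  by rewrite [a' * a]mulrC [b' * b]mulrC.
pose g' := (fun z => d^-1%:H *: g z).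
have g'_lin : linear g' by move=> c x z; rewrite /g' linearP scalerDr scalHC.
pose gl : {linear principal_series k0 nu' mu' -> principal_series k0 nu mu} :=
  HB.pack g' (GRing.isLinear.Build H _ _ *:%R g' g'_lin).
apply: (@simple_iso _ _ _ f gl) => x.
  apply: (@ps_linear_ext _ _ _ (gl \o f) idfun).
  by rewrite /= /g' fm gy' scalHA mulVf // scalH1.
apply: (@ps_linear_ext _ _ _ (f \o gl) idfun).
by rewrite /= /g' gm' linearZ /= fy scalHA mulVf // scalH1.
Qed.

End MapsBetweenPrincipalSeries.
End ModelFormulas.

(** * Simplicity along the orbit, and its failure *)

Section Simplicity.
Variables (R : realType) (r n : nat) (xi : R[i]).
Variable hxi : r.-primitive_root xi.
Local Notation C := R[i].
Local Notation theta i := (@theta_torus R r n xi hxi i).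
Variable k0 : C.
Local Notation H := (hecke n hxi k0).
Local Notation kappa := (r%:R * k0).
Local Notation hs w := (@ht R r n xi hxi k0 (of_perm hxi w)).
Local Notation hT t := (@ht R r n xi hxi k0 (of_torus t)).
Local Notation "c %:H" := (c%:A : H) (at level 2, format "c %:H").
Implicit Types (nu : {scalar 'cV[C]_n}) (mu : tchar n hxi) (l : 'I_n -> C).
Local Notation PS nu mu := (principal_series k0 nu mu).

Lemma eweight_eq (W : lmodType H) l l' (x : W) :
  l =1 l' -> eweight l x -> eweight l' x.
Proof. by move=> E lx j; rewrite lx E. Qed.

Lemma same_class_eq mu mu' i j :
  mu =1 mu' -> same_class mu i j = same_class mu' i j.
Proof. by move=> E; rewrite /same_class !E. Qed.

Lemma tchar_actK s mu mu' : (s * s = 1)%g ->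
  mu' =1 tchar_act s mu -> mu =1 tchar_act s mu'.
Proof.
move=> ss E; apply: eq_tchar => i; rewrite tchar_act_theta E tchar_act_theta.
by rewrite -permM -invMg ss invg1 perm1.
Qed.

(** The composite of the two intertwiners is (r k_0)^2 - (nu_i - nu_(i+1))^2 if
i and i+1 are equivalent, and 1 otherwise. *)
Lemma simple_adjacent nu nu' mu mu' (i i' : 'I_n) : i' = i.+1 :> nat ->
  (forall j, eweights nu' j = eweights nu (tperm i i' j)) ->
  mu' =1 tchar_act (tperm i i') mu ->
  (same_class mu i i' ->
    (eweights nu i - eweights nu i') ^+ 2 != kappa ^+ 2) ->
  simple_module (PS nu mu) -> simple_module (PS nu' mu').
Proof.
move=> ii' nuE muE ok; set s := tperm i i'.
have ss : (s * s = 1)%g by exact: tperm2.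
have muE' := tchar_actK ss muE.
have nuE' j : eweights nu j = eweights nu' (s j).
  by rewrite nuE -permM ss perm1.
have mut := @psgen_tweight _ _ _ _ _ k0 nu mu.
have nut := @psgen_eweight _ _ _ _ _ k0 nu mu.
have mut' := @psgen_tweight _ _ _ _ _ k0 nu' mu'.
have nut' := @psgen_eweight _ _ _ _ _ k0 nu' mu'.
have same' : same_class mu' i i' = same_class mu i i'.
  rewrite (same_class_eq _ _ muE) same_class_act tpermV tpermL tpermR.
  exact: same_class_sym.
have dE : eweights nu' i - eweights nu' i'
        = - (eweights nu i - eweights nu i').
  by rewrite !nuE tpermL tpermR opprB.
set d := eweights nu i - eweights nu i' in ok dE.
have key a b : b * d = a * (if same_class mu i i' then kappa else 0) ->
    b = 0 \/ same_class mu i i' -> a ^+ 2 != b ^+ 2 ->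
    simple_module (PS nu mu) -> simple_module (PS nu' mu').
  move=> abd b0 ab.
  have [y1 y2] := intertwine ii' mut nut abd b0.
  have abd' : b * (eweights nu' i - eweights nu' i')
      = - a * (if same_class mu' i i' then kappa else 0).
    by rewrite dE same' mulrN abd mulNr.
  have b0' : b = 0 \/ same_class mu' i i' by rewrite same'.
  have [z1 z2] := intertwine ii' mut' nut' abd' b0'.
  apply: (simple_exchange ss _ _ _ _ (a := a) (b := b) (a' := - a) (b' := b)).
  - by apply: tweight_eq y1 => t; rewrite muE.
  - by apply: eweight_eq y2 => j; rewrite nuE.
  - by apply: tweight_eq z1 => t; rewrite muE'.
  - by apply: eweight_eq z2 => j; rewrite nuE'.
  - by rewrite mulrN addrC -!expr2 subr_eq0 eq_sym.
  - by rewrite mulrN [b * a]mulrC subrr.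
case: (boolP (same_class mu i i')) key => [same_ii'|_] key.
  apply: (key d kappa); [exact: mulrC|by right|exact: ok].
by apply: (key 1 0); rewrite ?mul0r ?mulr0 ?expr1n ?expr0n ?oner_neq0 //; left.
Qed.

(** At such a weight the intertwiner is not injective: its image consists of
vectors that are eigenvectors of the right multiplication by s, and misses the
generator. *)
Lemma not_simple_adjacent nu mu (i i' : 'I_n) (eps : C) : i' = i.+1 :> nat ->
  same_class mu i i' -> eweights nu i - eweights nu i' = eps * kappa ->
  eps ^+ 2 = 1 -> ~ simple_module (PS nu mu).
Proof.
move=> ii' same_ii' dE eps2 [_ simpleM]; set m := psgen k0 nu mu.
set s := tperm i i'.
have ii'_neq : i != i' by rewrite -val_eqE /= ii' ltn_eqF.
have s1 : (s == 1%g) = false.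
  apply/eqP=> /permP/(_ i); rewrite tpermL perm1 => E.
  by rewrite E eqxx in ii'_neq.
have [f [g [fK gK fm]]] := ps_model_bijective k0 nu mu.
pose y := eps%:H *: (hs s *: m) + 1%:H *: m.
have y_weight : exists l' mu', tweight mu' y /\ eweight l' y.
  have [||y1 y2] := intertwine ii' (@psgen_tweight _ _ _ _ _ k0 nu mu)
    (@psgen_eweight _ _ _ _ _ k0 nu mu) (a := eps) (b := 1).
  - by rewrite mul1r same_ii'.
  - by right.
  by exists (fun j => eweights nu (s j)), (tchar_act s mu).
have [l' [mu' [mu'y l'y]]] := y_weight.
(* Right multiplication by s, in the coordinates of the model. *)
pose anti (z : permfun R n) := forall a,
  val_at z (a * s)%g = eps * val_at z a.
have fyE a : val_at (f y : permfun R n) a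
    = eps * (s * a == 1)%g%:R + (a == 1%g)%:R.
  rewrite linearD !linearZ /= fm scalH1 val_atD model_scal val_atZ model_hs.
  by rewrite left_opE !dirac1E.
have anti_y : anti (f y).
  have sV : s^-1%g = s by exact: tpermV.
  move=> a; rewrite !fyE mulrDr mulrA -expr2 eps2 mul1r addrC.
  have -> : (s * (a * s) == 1)%g = (a == 1)%g.
    by rewrite -{1}sV; exact: conjg_eq1.
  congr ((nat_of_bool _)%:R + _).
  by rewrite -!eq_invg_mul sV (canF_eq invgK) sV eq_sym.
pose N := [pred z : PS nu mu | `[< exists h : H, z = h *: y >]].
have Nsub : submod_closed N.
  split=> [|h z z']; rewrite !inE.
    by apply/asboolP; exists 0; rewrite scale0r.
  move=> /asboolP[u ->] /asboolP[v ->]; apply/asboolP; exists (h * u + v).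
  by rewrite scalerDl scalerA.
case: (simpleM N Nsub) => [N0|NT].
  have y0 : y = 0.
    by apply: N0; rewrite inE; apply/asboolP; exists 1; rewrite scale1r.
  have := fyE 1%g; rewrite y0 linear0 val_at0 mulg1 s1 mulr0 add0r eqxx.
  by move/eqP; rewrite eq_sym oner_eq0.
have := NT m; rewrite inE => /asboolP[h mE].
have [c hyE] := weight_span mu'y l'y h.
have : anti (f m).
  rewrite mE hyE linear_sum => a; rewrite !model_sum mulr_sumr.
  apply: eq_bigr => w _;
    rewrite !linearZ /= !model_scal !val_atZ !model_hs !left_opE.
  by rewrite mulgA anti_y mulrCA.
move/(_ 1%g); rewrite fm !dirac1E mul1g s1 eqxx mulr1 => /esym eps0.
by move/eqP: eps2; rewrite eps0 expr0n eq_sym oner_eq0.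
Qed.

Lemma simple_eq_weights nu nu' mu mu' : eweights nu' =1 eweights nu ->
  mu' =1 mu -> simple_module (PS nu mu) -> simple_module (PS nu' mu').
Proof.
move=> nuE muE.
have mut := @psgen_tweight _ _ _ _ _ k0 nu mu.
have nut := @psgen_eweight _ _ _ _ _ k0 nu mu.
have mut' := @psgen_tweight _ _ _ _ _ k0 nu' mu'.
have nut' := @psgen_eweight _ _ _ _ _ k0 nu' mu'.
have E (W : lmodType H) (x : W) : 0%:H *: (hs 1%g *: x) + 1%:H *: x = x.
  by rewrite scalH0 add0r scalH1.
apply: (simple_exchange (mulg1 1%g) _ _ _ _
  (a := 0) (b := 1) (a' := 0) (b' := 1));
  rewrite ?E ?mulr0 ?mul0r ?mulr1 ?addr0 ?add0r ?oner_neq0 //.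
- by apply: tweight_eq mut => t; rewrite muE.
- by apply: eweight_eq nut => j; rewrite nuE.
- by apply: tweight_eq mut'.
- by apply: eweight_eq nut'.
Qed.

Lemma eweights_act w nu j :
  eweights (dual_act w nu) j = eweights nu (w^-1%g j).
Proof. exact: dual_act_basis. Qed.

(** Induction on a product of adjacent transpositions: one at which the
intertwiners fail to be invertible would contradict [not_simple_adjacent]. *)
Lemma simple_perm (u : 'S_n) nu nu' mu mu' :
  (forall j, eweights nu' j = eweights nu (u j)) ->
  (forall j, mu' (theta j) = mu (theta (u j))) ->
  simple_module (PS nu mu) -> simple_module (PS nu' mu').
Proof.
move=> nuE muE simpleM.
elim/perm_adjacent_ind: u nu' mu' nuE muE => [|u i i' ii' IH] nu' mu' nuE muE.
  apply: simple_eq_weights simpleM => [j|]; first by rewrite nuE perm1.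
  by apply: eq_tchar => j; rewrite muE perm1.
set s := tperm i i' in nuE muE *.
have ss : (s * s = 1)%g by exact: tperm2.
have sV : s^-1%g = s by exact: tpermV.
have simple'' : simple_module (PS (dual_act s nu') (tchar_act s mu')).
  apply: IH => j.
    by rewrite eweights_act sV nuE -permM mulgA ss mul1g.
  by rewrite tchar_act_theta sV muE -permM mulgA ss mul1g.
apply: (simple_adjacent (i := i) (i' := i') ii' _ _ _ simple'').
- by move=> j; rewrite eweights_act sV -permM ss perm1.
- exact: tchar_actK.
move=> same_ii'; apply: contra_not_neq (fun H => H simple'') => /eqP d2.
move: d2; rewrite eqf_sqr => /orP[] /eqP dE.
  by apply: (not_simple_adjacent ii' same_ii' (eps := 1));
    rewrite ?expr1n ?mul1r.
apply: (not_simple_adjacent ii' same_ii' (eps := -1));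
  last by rewrite sqrrN expr1n.
by rewrite mulN1r.
Qed.

(** The condition that characterizes simplicity. Exchanging i and j shows that
it excludes the value - r k_0 as well. *)
Definition regular_weight l mu := forall i j : 'I_n, i != j ->
  same_class mu i j -> l i - l j != kappa.

Lemma two_transitive (p p' i j : 'I_n) : p != p' -> i != j ->
  exists u : 'S_n, u p = i /\ u p' = j.
Proof.
move=> pp' ij; have tp : tperm p i p = i by exact: tpermL.
exists (tperm p i * tperm (tperm p i p') j)%g; rewrite !permM tp.
split; last exact: tpermL.
apply: tpermD; last by rewrite eq_sym.
by rewrite -[X in _ != X]tp (inj_eq perm_inj) eq_sym.
Qed.

(** A bad pair can be moved to the first two positions without losing
simplicity. *)
Lemma simple_regular nu mu : simple_module (PS nu mu) ->
  regular_weight (eweights nu) mu.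
Proof.
move=> simpleM i j ij same_ij; apply/eqP=> dE.
have n_gt1 : (1 < n)%N.
  rewrite ltnNge; apply: contra ij => n_le1; rewrite -val_eqE /=.
  have lt0 (k : 'I_n) : (k : nat) = 0%N.
    by apply/eqP; rewrite -leqn0 -ltnS; exact: leq_trans n_le1.
  by rewrite !lt0.
pose p := Ordinal (ltnW n_gt1); pose p' := Ordinal n_gt1.
have [u [up up']] := two_transitive (isT : p != p') ij.
pose nu' := dual_act u^-1 nu; pose mu' := tchar_act u^-1 mu.
have nuE q : eweights nu' q = eweights nu (u q) by rewrite eweights_act invgK.
have muE q : mu' (theta q) = mu (theta (u q)) by rewrite tchar_act_theta invgK.
have simple' := simple_perm nuE muE simpleM.
apply: (@not_simple_adjacent nu' mu' p p' 1) simple' => //.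
- by rewrite /same_class !muE up up'.
- by rewrite !nuE up up' mul1r.
- by rewrite expr1n.
Qed.

End Simplicity.

(** * Regular weights give simple modules *)

Section RegularSimple.
Variables (R : realType) (r n : nat) (xi : R[i]).
Variable hxi : r.-primitive_root xi.
Local Notation C := R[i].
Local Notation theta i := (@theta_torus R r n xi hxi i).
Variable k0 : C.
Local Notation H := (hecke n hxi k0).
Local Notation kappa := (r%:R * k0).
Local Notation hs w := (@ht R r n xi hxi k0 (of_perm hxi w)).
Local Notation hT t := (@ht R r n xi hxi k0 (of_torus t)).
Local Notation "c %:H" := (c%:A : H) (at level 2, format "c %:H").
Local Notation V := (permfun R n).

Section Model.
Variables (l : 'I_n -> C) (mu : tchar n hxi).
Local Notation M := (model k0 l mu).

Definition below m (x : M) := forall a, val_at x a != 0 -> (level a < m)%N.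

Lemma val_atNZ (c : C) (x y : M) a :
  val_at (y - c%:H *: x : M) a = val_at y a - c * val_at x a.
Proof.
by rewrite -scalHN [LHS]val_atD model_scal val_atZ mulNr.
Qed.

(** e_j is triangular: its value at a involves, besides a, only permutations
that are more disordered than a. *)
Lemma model_he_top (x : M) a j :
  (forall b, (level a < level b)%N -> val_at x b = 0) ->
  val_at (he hxi k0 j *: x : M) a = l (a j) * val_at x a.
Proof.
move=> top; rewrite model_he he_opE big1 ?mulr0 ?addr0 // => k _.
have [ak|ak|/val_inj/perm_inj ->] := ltngtP (a k) (a j); last first.
- by rewrite ltnn subrr mul0r.
- case: (ltnP j k) => [jk|_]; last by rewrite subrr mul0r.
  by rewrite top ?mulr0 //; exact/level_lt/disorder_lt.
case: (ltngtP j k) => [jk|kj|/val_inj jk].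
- by rewrite subrr mul0r.
- by rewrite tpermC top ?mulr0 //; exact/level_lt/disorder_lt.
- by rewrite jk ltnn in ak.
Qed.

(** Take a nonzero element x of the submodule whose support has the lowest
possible top level, reached at a. Subtracting from e_j x or t x its expected
multiple of x cancels the value at a, hence gives 0 by minimality. *)
Lemma submod_weight (N : {pred M}) (v : M) :
  submod_closed N -> v \in N -> v != 0 ->
  exists (x : M) (a : 'S_n), [/\ x \in N, x != 0,
    eweight (fun j => l (a j)) x & tweight (tchar_act a^-1%g mu) x].
Proof.
move=> [N0 NL] Nv v0.
have NB x y c : x \in N -> y \in N -> y - c%:H *: x \in N.
  by move=> Nx Ny; rewrite -scalHN addrC NL.
have NZ x (h : H) : x \in N -> h *: x \in N.
  by move=> Nx; rewrite -[h *: x]addr0 NL.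
pose P m := `[< exists2 x, x \in N & x != 0 /\ below m x >].
have exP : exists m, P m.
  exists (\max_(a : 'S_n) level a).+1; apply/asboolP; exists v => //;
    split=> // a _.
  by rewrite ltnS; exact: leq_bigmax.
case: (ex_minnP exP) => m /asboolP[x Nx [x0 xm]] min_m.
(* m is minimal, so the top level m - 1 is attained. *)
have [a xa am] : exists2 a, val_at x a != 0 & m = (level a).+1.
  apply: contrapT => noa.
  case: m xm min_m noa => [|m] xm min_m noa.
    by move/eqP: x0; apply; apply: permfunP => a; rewrite val_at0;
      apply/eqP; apply: contraT => /xm.
  suff /min_m : P m by rewrite ltnn.
  apply/asboolP; exists x => //; split=> // a xa.
  have := xm a xa; rewrite ltnS leq_eqVlt => /orP[/eqP am|//].
  by case: noa; exists a => //; rewrite am.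
have top b : (level a < level b)%N -> val_at x b = 0.
  move=> ab; apply/eqP; apply: contraTT ab => /xm.
  by rewrite am ltnS -leqNgt.
have lower y : y \in N ->
    (forall b, (level a <= level b)%N -> val_at y b = 0) -> y = 0.
  move=> Ny yb; apply/eqP; apply: contraT => y0.
  suff /min_m : P (level a) by rewrite am ltnn.
  apply/asboolP; exists y => //; split=> // b.
  by apply: contraNT; rewrite -leqNgt => /yb ->.
have split_level b : (level a <= level b)%N -> a = b \/ (level a < level b)%N.
  by rewrite leq_eqVlt => /orP[/eqP/level_inj|]; [left|right].
exists x, a; split=> // [j|t]; apply/eqP; rewrite -subr_eq0; apply/eqP.
  apply: lower => [|b ab]; first exact/NB/NZ.
  rewrite val_atNZ model_he_top => [|b' bb']; last first.
    by apply: top; exact: leq_ltn_trans ab bb'.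
  by case: (split_level b ab) => [<-|/top ->]; rewrite ?subrr // !mulr0 subrr.
apply: lower => [|b ab]; first exact/NB/NZ.
rewrite val_atNZ model_hT torus_opE.
by case: (split_level b ab) => [<-|/top ->]; rewrite ?subrr // !mulr0 subrr.
Qed.

(** Equal pairs (l_i, mu_i) occupy consecutive positions, so that the
stabilizer of the weight is a standard parabolic subgroup. *)
Definition contiguous_weight :=
  forall p q s : 'I_n, (p <= q <= s)%N -> l p = l s -> same_class mu p s ->
    l q = l s /\ same_class mu q s.

Hypothesis regular : regular_weight k0 l mu.
Hypothesis contiguous : contiguous_weight.

(** Downward induction on k shows that the support consists of permutations
that fix everything from k on. Otherwise let b be in the support with q = b k <
k smallest; the equations of e_k and theta_k at b give (l_q, mu_q) = (l_k,
mu_k), hence the same for q+1 by contiguity. The equation of e_k at b (q,q+1)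
then reads 0 = r k_0 x(b), and k_0 is nonzero because the weight is regular. *)
Lemma weight_vector_unique (x : M) : eweight l x -> tweight mu x ->
  forall a : 'S_n, a != 1%g -> val_at x a = 0.
Proof.
move=> lx mux.
have same_x a j : val_at x a != 0 -> same_class mu (a j) j.
  move=> xa; have /(congr1 (fun y : V => val_at y a)) := mux (theta j).
  rewrite model_hT torus_opE model_scal val_atZ torus_conj_theta invgK.
  by move/(mulIf xa)/eqP.
have fixes k : (k <= n)%N ->
    forall a, val_at x a != 0 -> forall j : 'I_n, (k <= j)%N -> a j = j.
  move=> kn; rewrite -(subKn kn);
    elim: (n - k)%N (leq_subr k n) => {k kn} [|d IHd] dn.
    by move=> a _ j; rewrite subn0 leqNgt ltn_ord.
  have lt_k : (n - d.+1 < n)%N by lia.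
  pose k := Ordinal lt_k.
  have fix_gt a : val_at x a != 0 -> forall j : 'I_n, (k < j)%N -> a j = j.
    by move=> xa j /= kj; apply: (IHd _ a xa j); lia.
  suff fix_k : forall a : 'S_n, val_at x a != 0 -> a k = k.
    move=> a xa j; rewrite leq_eqVlt => /orP[/eqP kj|]; last exact: fix_gt.
    by rewrite -(_ : k = j) ?fix_k //; exact: val_inj.
  (* The terms with j > k vanish, as x vanishes at permutations moving j. *)
  have eqn (a : 'S_n) : (forall j : 'I_n, (k < j)%N -> a j = j) ->
      (l k - l (a k)) * val_at x a = kappa *
        \sum_(j < n | [&& (j < k)%N, (a j < a k)%N & same_class mu (a k) (a j)])
          val_at x (tperm k j * a)%g.
    move=> a_gt; have /(congr1 (fun y : V => val_at y a)) := lx k.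
    rewrite model_he he_opE model_scal val_atZ mulrBl => <-.
    rewrite addrC addKr; congr (_ * _).
    rewrite [LHS]big_mkcond [RHS]big_mkcond; apply: eq_bigr => j _.
    have ak_le : (a k <= k)%N.
      rewrite leqNgt; apply/negP => kak.
      have /perm_inj ak : a (a k) = a k by exact: a_gt.
      by rewrite ak ltnn in kak.
    case: (ltngtP j k) => [jk|kj|/val_inj ->] /=.
    - by case: (a j < a k)%N; case: same_class; rewrite ?subr0 ?mul1r ?mul0r.
    - case: same_class => //; apply/eqP; rewrite mulf_eq0; apply/orP; right.
      apply: contraT => /fix_gt/(_ j kj); rewrite permM tpermR => akj.
      by move: kj; rewrite -akj ltnNge ak_le.
    - by rewrite ltnn subrr mul0r; case: same_class.
  move=> a xa; apply/eqP; apply: contraT => ak.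
  pose Q q := [exists b : 'S_n, (val_at x b != 0) && (b k == q :> nat)].
  have exQ : exists q, Q q.
    by exists (a k); apply/existsP; exists a; rewrite xa eqxx.
  case: (ex_minnP exQ) => q /existsP[b /andP[xb /eqP bk]] min_q.
  have q_lt : (q < k)%N.
    have ak_le : (a k < k)%N.
      rewrite ltn_neqAle val_eqE ak leqNgt; apply/negP => kak.
      have /perm_inj akk : a (a k) = a k by exact: fix_gt.
      by rewrite akk ltnn in kak.
    apply: leq_ltn_trans ak_le; apply: min_q; apply/existsP; exists a.
    by rewrite xa eqxx.
  have small (c : 'S_n) : (c k < q)%N -> val_at x c = 0.
    move=> cq; apply/eqP; apply: contraT => xc.
    have /min_q : Q (c k) by apply/existsP; exists c; rewrite xc eqxx.
    by rewrite leqNgt cq.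
  have b_gt := fix_gt b xb.
  have lkb : l k = l (b k).
    apply/eqP; rewrite -subr_eq0; have /eqP := eqn b b_gt.
    rewrite big1 ?mulr0 ?mulf_eq0 ?(negPf xb) ?orbF // => j /and3P[_ jk _].
    by apply: small; rewrite permM tpermL -bk.
  have same_bk := same_x b k xb.
  have bk_neq : k != b k by rewrite -val_eqE /= bk gtn_eqF.
  have kappa0 : kappa != 0.
    by have := regular bk_neq;
      rewrite same_class_sym same_bk lkb subrr eq_sym; exact.
  have lt_q1 : (q.+1 < n)%N by exact: leq_ltn_trans q_lt (ltn_ord k).
  pose q1 := Ordinal lt_q1.
  have [lq1 same_q1] : l q1 = l k /\ same_class mu q1 k.
    by apply: (@contiguous (b k)) => //; rewrite bk leqnSn.
  pose c := (b * tperm (b k) q1)%g.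
  have ck : c k = q1 by rewrite permM tpermL.
  have c_gt (j : 'I_n) : (k < j)%N -> c j = j.
    move=> kj; rewrite permM (b_gt j kj) tpermD // -val_eqE /= ?bk neq_ltn.
      by rewrite (ltn_trans q_lt kj).
    by rewrite (leq_ltn_trans q_lt kj).
  have := eqn c c_gt; rewrite ck lq1 subrr mul0r => /esym/eqP.
  rewrite mulf_eq0 (negPf kappa0) /= => /eqP sum0.
  (* In the sum only j0 contributes: elsewhere the value at k is below q. *)
  pose j0 := (b^-1 q1)%g.
  have bj0 : b j0 = q1 by rewrite permKV.
  have j0_lt : (j0 < k)%N.
    rewrite ltn_neqAle leqNgt; apply/andP; split; last first.
      apply/negP=> kj0; have := b_gt _ kj0; rewrite bj0 => q1j0.
      by move: kj0; rewrite -q1j0 ltnNge q_lt.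
    rewrite val_eqE; apply/eqP=> j0k; move: bj0; rewrite j0k => /(congr1 val).
    by rewrite /= bk => /n_Sn.
  have cj0 : c j0 = b k by rewrite permM bj0 tpermR.
  move: sum0; rewrite (bigD1 j0) /=; last first.
    rewrite j0_lt cj0 bk ltnSn /=.
    by rewrite /same_class (eqP same_q1) eq_sym; exact: same_bk.
  rewrite big1 => [|j /andP[/and3P[_ cj _] jj0]].
    rewrite addr0 tperm_mulg ck cj0 [tperm q1 _]tpermC -mulgA tperm2 mulg1.
    by move/eqP; rewrite (negPf xb).
  apply: small; rewrite permM tpermL ltn_neqAle -ltnS cj andbT -bk val_eqE.
  by rewrite -cj0 (inj_eq perm_inj).
move=> a a1; apply/eqP; apply: contraNT a1 => xa.
by apply/eqP/permP => j; rewrite perm1 (fixes 0%N).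
Qed.

Lemma dirac1_neq0 : (@dirac1 R n : M) != 0.
Proof.
apply/eqP=> /(congr1 (fun x : V => val_at x 1%g)).
by rewrite dirac1E eqxx val_at0 => /eqP; rewrite oner_eq0.
Qed.

End Model.

(** The intertwiners are injective on weight vectors of regular weight, since
applying the opposite one multiplies by a nonzero scalar. *)
Lemma weight_vector_move (W : lmodType H) (x : W) l (mu : tchar n hxi)
    (u : 'S_n) :
  regular_weight k0 l mu -> eweight l x -> tweight mu x -> x != 0 ->
  exists2 h : H, h *: x != 0 & eweight (fun j => l (u j)) (h *: x) /\
    exists2 mu' : tchar n hxi, (forall j, mu' (theta j) = mu (theta (u j))) &
      tweight mu' (h *: x).
Proof.
move=> reg lx mux x0;
  elim/perm_adjacent_ind: u => [|u i i' ii' [h hx0 [lhx [mu' mu'E mu'hx]]]].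
  exists 1; rewrite scale1r //; split; first by move=> j; rewrite perm1.
  by exists mu => // j; rewrite perm1.
set s := tperm i i'; set z := h *: x in hx0 lhx mu'hx.
have i_neq : u i != u i'.
  by rewrite (inj_eq perm_inj) -val_eqE /= ii' ltn_eqF.
have sE : same_class mu' i i' = same_class mu (u i) (u i').
  by rewrite /same_class !mu'E.
have key a b : b * (l (u i) - l (u i')) =
      a * (if same_class mu' i i' then kappa else 0) ->
    b = 0 \/ same_class mu' i i' -> a ^+ 2 != b ^+ 2 ->
    exists2 h : H, h *: x != 0 & eweight (fun j => l ((s * u)%g j)) (h *: x) /\
      exists2 mu' : tchar n hxi,
        (forall j, mu' (theta j) = mu (theta ((s * u)%g j))) &
        tweight mu' (h *: x).
  move=> abd b0 ab; have [y1 y2] := intertwine ii' mu'hx lhx abd b0.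
  set y := a%:H *: _ + _ in y1 y2.
  have yE : y = ((a%:H * hs s + b%:H) * h) *: x.
    by rewrite -scalerA scalerDl -scalerA.
  exists ((a%:H * hs s + b%:H) * h); rewrite -yE.
    apply: contraNneq hx0 => y0.
    apply/eqP/(@scalH_eq0 _ _ _ _ _ _ _ (a ^+ 2 - b ^+ 2)).
      by rewrite subr_eq0.
    (* This uses (a s - b) (a s + b) = a^2 - b^2. *)
    have : a%:H *: (hs s *: y) - b%:H *: y = 0 by rewrite y0 !scaler0 subrr.
    rewrite /y !scalerDr (scalHC a) (scalHC b) hs_tpermK !scalHA.
    rewrite opprD [- _ - _]addrC addrACA [b * a]mulrC subrr addr0 => <-.
    by rewrite -scalHN -scalHD !expr2.
  split; first by move=> j; rewrite y2 permM.
  exists (tchar_act s mu') => // j;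
    rewrite tchar_act_theta tpermV mu'E permM //.
case: (boolP (same_class mu' i i')) key => [same_ii'|_] key.
  apply: (key (l (u i) - l (u i')) kappa); [exact: mulrC|by right|].
  rewrite eqf_sqr negb_or; rewrite sE in same_ii'.
  by rewrite reg //= -opprB eqr_opp reg // 1?eq_sym // same_class_sym.
by apply: (key 1 0); rewrite ?mul0r ?mulr0 ?expr1n ?expr0n ?oner_neq0 //; left.
Qed.

Lemma simple_model l (mu : tchar n hxi) :
  regular_weight k0 l mu -> contiguous_weight l mu ->
  simple_module (model k0 l mu).
Proof.
move=> reg cont; set M := model k0 l mu; split.
  by exists (@dirac1 R n); exact: dirac1_neq0.
move=> N Nsub; have [N0 NL] := Nsub.
have [[v Nv v0]|noN] := EM (exists2 v, v \in N & v != 0); last first.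
  left=> v Nv; apply/eqP; apply: contrapT => v0; apply: noN.
  by exists v => //; exact/negP.
right; have NZ x (h : H) : x \in N -> h *: x \in N.
  by move=> Nx; rewrite -[h *: x]addr0 NL.
have [x [a [Nx x0 ax amux]]] := submod_weight Nsub Nv v0.
have rega : regular_weight k0 (fun j => l (a j)) (tchar_act a^-1%g mu).
  move=> i j ij; rewrite same_class_act invgK => same_ij.
  by apply: reg; rewrite ?(inj_eq perm_inj).
have [h hx0 [lhx [mu' mu'E mu'hx]]] :=
  weight_vector_move a^-1%g rega ax amux x0.
set y := h *: x in hx0 lhx mu'hx.
have ly : eweight l y by apply: eweight_eq lhx => j; rewrite permKV.
have muy : tweight mu y.
  apply: tweight_eq mu'hx; apply: eq_tchar => j.
  by rewrite mu'E tchar_act_theta invgK permKV.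
have Ny : y \in N by exact: NZ.
have yE := weight_vector_unique reg cont ly muy.
set c := val_at y 1%g.
have ydirac : y = c%:H *: (@dirac1 R n : M).
  apply: permfunP => b; rewrite model_scal val_atZ dirac1E.
  by case: eqP => [->|/eqP/yE ->]; rewrite ?mulr1 ?mulr0.
have c0 : c != 0.
  by apply: contraNneq hx0 => c0; rewrite ydirac c0 scalH0.
have Nd : (@dirac1 R n : M) \in N.
  have -> : (@dirac1 R n : M) = c^-1%:H *: y.
    by rewrite ydirac scalHA mulVf // scalH1.
  exact: NZ.
move=> z; rewrite (model_span z).
apply: (big_ind (fun z => z \in N)) => // [z1 z2 N1 N2|w _].
  by rewrite -[z1]scale1r NL.
exact/NZ/NZ.
Qed.

(** Sort the positions by the index of the first occurrence of the pair (l_i,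
mu_i). *)
Lemma contiguous_order l (mu : tchar n hxi) : exists u : 'S_n,
  contiguous_weight (fun j => l (u j)) (tchar_act u^-1%g mu).
Proof.
pose label (p : 'I_n) := (l p, mu (theta p)).
pose labels := [seq label q | q <- enum 'I_n].
have label_in p : label p \in labels by apply: map_f; rewrite mem_enum.
have [u u_sorted] := perm_sorting (fun p => index (label p) labels).
exists u => p q s /andP[pq qs] lps; rewrite same_class_act invgK => mups.
suff [-> muqs] : label (u q) = label (u s).
  by rewrite same_class_act invgK /same_class muqs.
have lab : label (u p) = label (u s) by rewrite /label lps (eqP mups).
rewrite -(nth_index (label (u s)) (label_in (u q))).
rewrite -[RHS](nth_index (label (u s)) (label_in (u s))); congr nth.
apply/eqP; rewrite eqn_leq u_sorted //= -lab.
exact: u_sorted.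
Qed.

Lemma simple_iff_regular (nu : {scalar 'cV[C]_n}) (mu : tchar n hxi) :
  simple_module (principal_series k0 nu mu) <->
  regular_weight k0 (eweights nu) mu.
Proof.
split=> [|reg]; first exact: simple_regular.
have [u cont] := contiguous_order (eweights nu) mu.
pose nu' := dual_act u^-1%g nu; pose mu' := tchar_act u^-1%g mu.
have nuE j : eweights nu' j = eweights nu (u j) by rewrite eweights_act invgK.
have simple' : simple_module (principal_series k0 nu' mu').
  have [f [g [fK gK _]]] := ps_model_bijective k0 nu' mu'.
  apply: (simple_iso gK fK); apply: simple_model.
    move=> i j ij; rewrite same_class_act invgK !nuE => same_ij.
    by apply: reg; rewrite ?(inj_eq perm_inj).
  move=> p q s pqs; rewrite !nuE; exact: cont.
apply: (simple_perm (u := u^-1%g) _ _ simple') => j;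
  first by rewrite nuE permKV.
by rewrite tchar_act_theta invgK permKV.
Qed.

Lemma regular_weight_act (w : 'S_n) (nu : {scalar 'cV[C]_n})
    (mu : tchar n hxi) :
  regular_weight k0 (eweights nu) mu ->
  regular_weight k0 (eweights (dual_act w nu)) (tchar_act w mu).
Proof.
move=> reg i j ij; rewrite same_class_act !eweights_act => same_ij.
by apply: reg; rewrite ?(inj_eq perm_inj).
Qed.

Lemma tperm_stab (mu : tchar n hxi) (i j : 'I_n) :
  (tperm i j \in tchar_stab mu) = same_class mu i j.
Proof.
rewrite inE; apply/asboolP/idP => [/(_ (theta j))|/eqP mu_ij].
  by rewrite tchar_act_theta tpermV tpermR => /eqP.
apply: eq_tchar => p; rewrite tchar_act_theta tpermV.
by case: tpermP => // ->.
Qed.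

(** The index i of the twisted weight corresponds to the index sigma^-1 i of
(nu, varpi). *)
Lemma Pset0_regular (nu : {scalar 'cV[C]_n}) (varpi : tchar n hxi)
    (sigma : 'S_n) :
  tchar_act sigma varpi =1 mu_of varpi ->
  Pset k0 varpi (dual_act sigma nu) = set0 <->
  regular_weight k0 (eweights nu) varpi.
Proof.
move=> sigmaE.
have sameE i j : same_class (mu_of varpi) i j
    = same_class varpi (sigma^-1%g i) (sigma^-1%g j).
  by rewrite -same_class_act /same_class -!sigmaE.
have difE i j : dual_act sigma nu (basis_vec R i - basis_vec R j) =
    eweights nu (sigma^-1%g i) - eweights nu (sigma^-1%g j).
  by rewrite linearB !dual_act_basis.
split=> [P0 i j ij same_ij|reg].
  apply/eqP=> dE.
  have : tperm (sigma i) (sigma j) \in Pset k0 varpi (dual_act sigma nu).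
    rewrite inE tperm_stab sameE !permK same_ij andTb.
    apply/existsP; exists (sigma i); apply/existsP; exists (sigma j).
    by rewrite (inj_eq perm_inj) ij eqxx difE !permK dE eqxx.
  by rewrite P0 inE.
apply/setP => w; rewrite inE [RHS]inE; apply/negP => /andP[stab_w].
move=> /existsP[i /existsP[j /and3P[ij /eqP wE]]].
rewrite difE; rewrite wE tperm_stab sameE in stab_w.
have ij' : sigma^-1%g i != sigma^-1%g j by rewrite (inj_eq perm_inj).
case/orP => /eqP dE; first by have := reg _ _ ij' stab_w; rewrite dE eqxx.
rewrite same_class_sym eq_sym in stab_w ij'.
by have := reg _ _ ij' stab_w; rewrite -opprB dE opprK eqxx.
Qed.

End RegularSimple.

Theorem theorem4p9 (R : realType) (r n : nat) (hr : (1 <= r)%N) (hn : (1 <= n)%N)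
    (xi : R[i]) (hxi : r.-primitive_root xi) (k0 : R[i])
    (nu : {scalar 'cV[R[i]]_n}) (varpi : tchar n hxi) (sigma : 'S_n)
    (hsigma : tchar_act sigma varpi =1 mu_of varpi)
    (hinv : forall i j : 'I_n,
       [set i; j] \in inversions sigma -> exponent varpi i != exponent varpi j) :
  (simple_module (principal_series k0 nu varpi) <->
   (forall w : 'S_n,
      simple_module (principal_series k0 (dual_act w nu) (tchar_act w varpi)))) /\
  (simple_module (principal_series k0 nu varpi) <->
   Pset k0 varpi (dual_act sigma nu) = set0).
Proof.
split; last by rewrite Pset0_regular //; exact: simple_iff_regular.
split=> [simpleM w|simple_all].
  by apply/simple_iff_regular/regular_weight_act/simple_iff_regular.
apply: (simple_perm (u := 1%g) _ _ (simple_all 1%g)) => j; rewrite perm1.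
  by rewrite eweights_act invg1 perm1.
by rewrite tchar_act_theta invg1 perm1.
Qed.
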